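(* There exist positive constants $(c_d)_{d\ge5}$ such that for any $n\ge2$ and $\zeta>0$, $$\mathbb P\big(\mathrm{Cap}(\mathcal R_n)-\mathbb E[\mathrm{Cap}(\mathcal R_n)]\ge\zeta\big)\ \le\ \begin{cases}\exp\left(-c_5\cdot\frac{\zeta^2}{n(\log n)^3}\right) & \text{if }d=5,\\[4pt] \exp\left(-c_6\cdot\frac{\zeta^2}{n(\log\log n)^2}\right) & \text{if }d=6,\\[4pt] \exp\left(-c_d\cdot\frac{\zeta^2}{n}\right) & \text{if }d\ge7.\end{cases}$$
   Context: $(S_n)_{n\ge 0}$ is the simple random walk on $\mathbb Z^d$ started from the origin, and $\mathcal R_n:=\{S_0,\dots,S_n\}$. $\mathbb P_x$ is the law of a simple random walk started from $x$, $\mathbb P=\mathbb P_0$. For $A\subset\mathbb Z^d$, $H_A^+:=\inf\{n\ge 1: S_n\in A\}$. The capacity of a finite set $A\subset \mathbb Z^d$ is $\mathrm{Cap}(A):=\sum_{x\in A}\mathbb P_x(H_A^+=\infty)$, and $\mathrm{Cap}(\mathcal R_n)$ is this set function evaluated at the random set $\mathcal R_n$. *)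

(* Defs.v *)
From HB Require Import structures.
From mathcomp Require Import all_boot all_order all_algebra finmap.
From mathcomp Require Import all_classical all_reals all_analysis.

Set Implicit Arguments.
Unset Strict Implicit.
Unset Printing Implicit Defensive.

Import Order.TTheory GRing.Theory Num.Theory.

Local Open Scope classical_set_scope.
Local Open Scope ring_scope.

Notation Zlattice d := 'rV[int]_d.

Definition unit_step (d : nat) (e : Zlattice d) : Prop :=
  exists (i : 'I_d) (b : bool), e = (-1) ^+ b *: delta_mx 0 i.

(* [V] is meant to be countable and carries the discrete sigma-algebra, so the
   events generated by [X n] are the preimages of arbitrary sets [B n]. *)
Definition mutually_independent (disp : measure_display)
    (T : measurableType disp) (R : realType) (P : probability T R)
    (V : Type) (X : nat -> T -> V) : Prop :=
  forall (J : {fset nat}) (B : nat -> set V),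
    P (\bigcap_(n in [set` J]) (X n @^-1` B n)) =
    (\prod_(n <- J) P (X n @^-1` B n))%E.

(* [S] is a simple random walk started from [x] under [P]: this determines the
   joint law of the whole sequence [S].  The starting point is only prescribed
   almost surely, so that one process [S] can be a walk started from [x] under
   a measure [P x], for every [x] simultaneously. *)
Record simple_random_walk (disp : measure_display)
    (T : measurableType disp) (R : realType) (d : nat) (P : probability T R)
    (S : nat -> T -> Zlattice d) (x : Zlattice d) : Prop := {
  srw_measurable : forall n (B : set (Zlattice d)), measurable (S n @^-1` B) ;
  srw_start : P [set w | S 0%N w = x] = 1%E ;
  srw_step : forall n (e : Zlattice d), unit_step e ->
    P [set w | S n.+1 w - S n w = e] = ((2 * d)%:R^-1)%:E ;
  srw_indep : mutually_independent P (fun n w => S n.+1 w - S n w) }.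

Definition walk_range (T : Type) (d : nat) (S : nat -> T -> Zlattice d)
    (n : nat) (w : T) : set (Zlattice d) :=
  [set S k w | k in [set k | (k <= n)%N]].

Definition return_time (T : Type) (R : realType) (d : nat)
    (S : nat -> T -> Zlattice d) (A : set (Zlattice d)) (w : T) : \bar R :=
  ereal_inf [set n%:R%:E | n in [set n | (1 <= n)%N /\ A (S n w)]].

(* Meaningful for finite [A] only: [\sum_(x \in A)] is 0 by convention when
   infinitely many terms are nonzero. *)
Definition capacity (disp : measure_display) (T : measurableType disp)
    (R : realType) (d : nat) (P : Zlattice d -> probability T R)
    (S : nat -> T -> Zlattice d) (A : set (Zlattice d)) : R :=
  \sum_(x \in A) fine (P x [set w | return_time R S A w = +oo%E]).

(* Main.v *)
Require Import Defs.
From HB Require Import structures.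
From mathcomp Require Import all_boot all_order all_algebra finmap zify ring lra.
From mathcomp Require Import all_classical all_reals all_analysis measurable_realfun.

Set Implicit Arguments.
Unset Strict Implicit.
Unset Printing Implicit Defensive.

Import Order.TTheory GRing.Theory Num.Theory numFieldNormedType.Exports.

Local Open Scope classical_set_scope.
Local Open Scope ring_scope.

(* Split the walk in two halves.  The capacity is translation invariant and
   subadditive, so Cap(R_n) is the sum of two independent copies of itself for
   half the time, minus a nonnegative overlap chi.  For a nonnegative variable,
   E exp(-t chi) <= 1 - t E chi + t^2 E chi^2: the upper tail of E chi - chi is
   Gaussian with variance of order E chi^2, with no boundedness assumption.
   Iterating down to single points, whose capacity is deterministic, the
   standard deviation proxies satisfy
     sigma_n <= sqrt(sigma_a^2 + sigma_b^2) + C sqrt(E chi^2).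
   Moreover chi is at most twice the sum of the Green function over pairs of
   points of the two halves, and p_m(x) <= K m^(-alpha) with alpha <= d / 2 gives
   E chi^2 <= C n^(6 - 2 alpha).  Taking alpha = 5/2 for d = 5 yields
   sigma_n <= C sqrt(n) log n, and alpha = 11/4 for d >= 6 yields
   sigma_n <= C sqrt(n), which is slightly more than needed when d <= 6.
   Escape probabilities are truncated at time M, which makes every average
   finite, and M tends to infinity only at the very end. *)

(** * Power sums *)

Section power_sums.
Context {R : realType}.
Implicit Types r s : R.

(** The base is shifted by one so that negative powers are meaningful at time 0. *)
Definition npow (k : nat) (r : R) : R := k.+1%:R `^ r.

Lemma npow_gt0 k r : 0 < npow k r.
Proof. by rewrite powR_gt0 ?ltr0n. Qed.

Lemma npow_ge0 k r : 0 <= npow k r.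
Proof. exact/ltW/npow_gt0. Qed.

Lemma npowD k r s : npow k (r + s) = npow k r * npow k s.
Proof. by rewrite /npow powRD// pnatr_eq0 implybT. Qed.

Lemma npowB1 k r : npow k (r - 1) = npow k r / k.+1%:R.
Proof. by rewrite npowD {2}/npow powR_inv1. Qed.

Lemma npow_le_expo k r s : r <= s -> npow k r <= npow k s.
Proof. by move=> rs; rewrite /npow ler_powR// ler1n. Qed.

Lemma npow_le j k r : r <= 0 -> (j <= k)%N -> npow k r <= npow j r.
Proof.
move=> r0 jk; rewrite -(opprK r) /npow powRN [leRHS]powRN.
rewrite lef_pV2 ?posrE ?powR_gt0 ?ltr0n//.
by rewrite ge0_ler_powR ?nnegrE ?oppr_ge0// ler_nat ltnS.
Qed.

Lemma npow_ge j k r : 0 <= r -> (j <= k)%N -> npow j r <= npow k r.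
Proof.
by move=> r0 jk; rewrite /npow ge0_ler_powR ?nnegrE// ler_nat ltnS.
Qed.

Lemma npow1 k : npow k 1 = k.+1%:R.
Proof. by rewrite /npow powRr1. Qed.

(** The ratio of consecutive powers is put in exponential form, so that both difference estimates
    below reduce to [1 + x <= expR x]. *)
Lemma npow_ratio k r :
  npow k r = npow k.+1 r * expR (r * ln (1 - (k.+2%:R)^-1)).
Proof.
have k1 : 0 < 1 - (k.+2%:R : R)^-1.
  by rewrite subr_gt0 invf_lt1 ?ltr0n// ltr1n.
have e : (k.+1%:R : R) = k.+2%:R * (1 - k.+2%:R^-1).
  by rewrite mulrBr mulr1 divff ?pnatr_eq0// -[in RHS]natr1 addrK.
rewrite /npow {1}e.
rewrite powRM// ?ltW//; congr (_ * _).
by rewrite /powR gt_eqF.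
Qed.

Lemma ln_one_minus_inv k : ln (1 - (k.+2%:R)^-1) <= - (k.+2%:R : R)^-1.
Proof.
apply: le_ln1Dx; rewrite ltrN2 invf_lt1 ?ltr0n// ltr1n//.
Qed.

(** A discrete derivative in place of a comparison with an integral: the right-hand side telescopes
    when summed. *)
Lemma npow_diff_neg k s : 1 < s ->
  (s - 1) * npow k.+1 (- s) <= npow k (1 - s) - npow k.+1 (1 - s).
Proof.
move=> s1; rewrite (npow_ratio k) -[X in _ <= _ - X]mulr1 -mulrBr.
have -> : npow k.+1 (- s) = npow k.+1 (1 - s) / k.+2%:R.
  by rewrite -npowB1; congr npow; lra.
rewrite mulrCA ler_pM2l ?npow_gt0//.
rewrite lerBrDr addrC; apply: le_trans (expR_ge1Dx _).
rewrite lerD2l -mulrNN opprB ler_nM2l ?subr_lt0//.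
exact: ln_one_minus_inv.
Qed.

(** With [u = 1 / (k + 2)], the relative gain is at least [r u / (1 + r u)], and [r u <= 1] costs
    the factor 1/2. *)
Lemma npow_diff_pos k r : 0 < r -> r <= 1 ->
  r / 2 * npow k.+1 (r - 1) <= npow k.+1 r - npow k r.
Proof.
move=> r0 r1; rewrite (npow_ratio k) -[X in _ <= X - _]mulr1 -mulrBr.
rewrite npowB1 mulrCA ler_pM2l ?npow_gt0//.
set u := k.+2%:R^-1; have u0 : 0 < u by rewrite invr_gt0 ltr0n.
have u1 : u <= 1 by rewrite invf_le1 ?ltr0n// ler1n.
have ru1 : 0 < r * u <= 1 by rewrite mulr_gt0//= mulr_ile1// ltW.
have h : expR (r * ln (1 - u)) <= (1 + r * u)^-1.
  apply: (@le_trans _ _ (expR (- (r * u)))).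
    by rewrite ler_expR -mulrN ler_pM2l//; exact: ln_one_minus_inv.
  rewrite expRN lef_pV2 ?posrE ?expR_gt0 ?expR_ge1Dx//.
  by case/andP: ru1; lra.
apply: (@le_trans _ _ (1 - (1 + r * u)^-1)); last by rewrite lerD2l lerN2.
have -> : 1 - (1 + r * u)^-1 = r * u / (1 + r * u) by field; lra.
rewrite mulrAC ler_pM2l; last by case/andP: ru1.
by rewrite lef_pV2 ?posrE//; lra.
Qed.

Lemma sum_npow_tail s m M : 1 < s ->
  \sum_(m <= k < M) npow k (- s) <= (1 + (s - 1)^-1) * npow m (1 - s).
Proof.
move=> s1; have s0 : 0 < s - 1 by lra.
have C0 : 0 < 1 + (s - 1)^-1 by rewrite addr_gt0// invr_gt0.
have [Mm|mM] := leqP M m.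
  by rewrite big_geq// mulr_ge0 ?npow_ge0// ltW.
rewrite big_ltn// mulrDl mul1r lerD//; first by apply: npow_le_expo; lra.
rewrite big_add1.
apply: (@le_trans _ _
  ((s - 1)^-1 * \sum_(m <= k < M.-1) (npow k (1 - s) - npow k.+1 (1 - s)))).
  rewrite mulr_sumr ler_sum// => k _.
  by rewrite ler_pdivlMl// npow_diff_neg.
rewrite (telescope_sumr_eq (fun k => - npow k (1 - s))) => [| |k _]; last 2 first.
- by rewrite -ltnS prednK// (leq_trans _ mM).
- by rewrite opprK addrC.
by rewrite ler_pM2l ?invr_gt0// opprK addrC gerBl npow_ge0.
Qed.

Lemma sum_npow_head s m : 0 < s -> s < 1 ->
  \sum_(k < m.+1) npow k (- s) <= 2 / (1 - s) * npow m (1 - s).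
Proof.
move=> s0 s1; rewrite -ler_pdivrMl ?divr_gt0 ?subr_gt0// invf_div.
rewrite mulr_sumr; elim: m => [|m ih].
  by rewrite big_ord1 /npow !powR1 mulr1; lra.
rewrite big_ord_recr/=; have := @npow_diff_pos m (1 - s).
have -> : 1 - s - 1 = - s by lra.
by move=> /(_ _ _)h; have := h ltac:(lra) ltac:(lra); lra.
Qed.

End power_sums.

(** * Averages over words *)

Section word_average.
Context {R : realType} {T : finType}.
Implicit Types (g h : seq T -> R) (m n : nat) (u v w : seq T).

(** Expectation over a uniform word of length [n]. Recursion on the first letter makes conditioning
    on the first step a mere unfolding. *)
Fixpoint avg n g : R :=
  if n is n'.+1 then #|T|%:R^-1 * \sum_(s : T) avg n' (fun w => g (s :: w))
  else g [::].

Lemma avgS n g :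
  avg n.+1 g = #|T|%:R^-1 * \sum_(s : T) avg n (fun w => g (s :: w)).
Proof. by []. Qed.

Lemma eq_avg n g h :
  (forall w, size w = n -> g w = h w) -> avg n g = avg n h.
Proof.
elim: n g h => [|n ih] g h gh /=; first exact: gh.
by congr (_ * _); apply: eq_bigr => s _; apply: ih => w sw; rewrite gh//= sw.
Qed.

Lemma le_avg n g h :
  (forall w, size w = n -> g w <= h w) -> avg n g <= avg n h.
Proof.
elim: n g h => [|n ih] g h gh /=; first exact: gh.
rewrite ler_wpM2l ?invr_ge0// ler_sum// => s _.
by apply: ih => w sw; rewrite gh//= sw.
Qed.

Lemma avgD n g h : avg n (fun w => g w + h w) = avg n g + avg n h.
Proof.
elim: n g h => [//|n ih] g h /=.
by rewrite -mulrDr -big_split/=; congr (_ * _); apply: eq_bigr => s _.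
Qed.

Lemma avgZ n c g : avg n (fun w => c * g w) = c * avg n g.
Proof.
elim: n g => [//|n ih] g /=.
by rewrite [RHS]mulrCA [in RHS]mulr_sumr; congr (_ * _); apply: eq_bigr => s _.
Qed.

Lemma avgZr n c g : avg n (fun w => g w * c) = avg n g * c.
Proof.
by rewrite mulrC -avgZ; apply: eq_avg => w _; rewrite mulrC.
Qed.

Lemma avg0 n : avg n (fun=> 0) = 0.
Proof.
rewrite -[RHS](mul0r (avg n (fun=> 0))) -avgZ.
by apply: eq_avg => w _; rewrite mul0r.
Qed.

Lemma avgN n g : avg n (fun w => - g w) = - avg n g.
Proof.
by rewrite -mulN1r -avgZ; apply: eq_avg => w _; rewrite mulN1r.
Qed.

Lemma avgB n g h : avg n (fun w => g w - h w) = avg n g - avg n h.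
Proof. by rewrite avgD avgN. Qed.

Lemma avg_sum I (r : seq I) (P : pred I) n (g : I -> seq T -> R) :
  avg n (fun w => \sum_(i <- r | P i) g i w) = \sum_(i <- r | P i) avg n (g i).
Proof.
elim: r => [|i r ih].
  by rewrite big_nil -[RHS](avg0 n); apply: eq_avg => w _; rewrite big_nil.
rewrite big_cons -ih; case: ifPn => Pi; rewrite -?avgD; apply: eq_avg => w _;
  by rewrite big_cons ?Pi ?(negbTE Pi).
Qed.

Lemma avg_ge0 n g : (forall w, size w = n -> 0 <= g w) -> 0 <= avg n g.
Proof. by move=> g0; rewrite -(avg0 n); exact: le_avg. Qed.

Lemma avg_cat m n g :
  avg (m + n) g = avg m (fun u => avg n (fun v => g (u ++ v))).
Proof.
by elim: m g => [//|m ih] g /=; congr (_ * _); apply: eq_bigr => s _; rewrite ih.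
Qed.

Lemma avg_avgC (m n : nat) (f : seq T -> seq T -> R) :
  avg m (fun u => avg n (fun v => f u v)) =
  avg n (fun v => avg m (fun u => f u v)).
Proof.
elim: m f => [//|m ih] f /=.
under eq_bigr do rewrite ih.
by rewrite avgZ -avg_sum.
Qed.

Lemma cvg_avg n (g : nat -> seq T -> R) h :
  (forall w, size w = n -> g M w @[M --> \oo] --> h w) ->
  avg n (g M) @[M --> \oo] --> avg n h.
Proof.
elim: n g h => [|n ih] g h gh /=; first exact: gh.
apply: cvgMl_tmp; apply: cvg_big => [|s _].
  by move=> x; exact: add_continuous.
by apply: ih => w sw; apply: gh; rewrite /= sw.
Qed.

Hypothesis T_gt0 : (0 < #|T|)%N.

Lemma avg_cst n c : avg n (fun=> c) = c.
Proof.
elim: n => [//|n ih] /=; rewrite ih sumr_const -[c *+ _]mulr_natl mulKf//.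
by rewrite pnatr_eq0 -lt0n.
Qed.

Lemma sqr_avg_le n g : avg n g ^+ 2 <= avg n (fun w => g w ^+ 2).
Proof.
have := avg_ge0 (fun w (_ : size w = n) => sqr_ge0 (g w - avg n g)).
under eq_avg do rewrite sqrrB.
rewrite avgD avgB avg_cst.
have -> : avg n (fun w => g w * avg n g *+ 2) = avg n g ^+ 2 *+ 2.
  under eq_avg do rewrite -mulrnAr.
  by rewrite avgZr mulrnAr.
lra.
Qed.

(* Size biasing: a word weighted by its number of letters [a] is a word with
   one letter [a] inserted. *)
Lemma avg_count_bias n a g :
  (forall u v, perm_eq u v -> g u = g v) ->
  avg n.+1 (fun w => (count_mem a w)%:R * g w) =
  n.+1%:R / #|T|%:R * avg n (fun w => g (a :: w)).
Proof.
elim: n g => [|n ih] g gP.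
  rewrite /= (bigD1 a)//= eqxx addn0 !mul1r big1 ?addr0//.
  by move=> s /negbTE ->; rewrite mul0r.
rewrite avgS.
(* Either the first letter is the marked [a], or the marked [a] lies further on and is brought to
   the front by the invariance of [g] under permutation. *)
transitivity (#|T|%:R^-1 *
    \sum_(s : T) ((s == a)%:R * avg n.+1 (fun w => g (a :: w)) +
                  n.+1%:R / #|T|%:R * avg n (fun w => g (a :: s :: w)))).
  congr (_ * _); apply: eq_bigr => s _.
  under eq_avg do rewrite [count_mem a _]/= natrD mulrDl.
  rewrite avgD avgZ; congr (_ + _).
    by have [->//|_] := eqVneq s a; rewrite !mul0r.
  rewrite (ih (fun w => g (s :: w))); last first.
    by move=> u v uv; apply: gP; rewrite perm_cons.
  congr (_ * _); apply: eq_avg => w _; apply: gP.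
  rewrite -[a :: s :: w]/([:: a; s] ++ w) -[s :: a :: w]/([:: s; a] ++ w).
  by rewrite perm_cat2r (perm_catC [:: s] [:: a]).
rewrite big_split/= -mulr_sumr mulrDr [X in _ + X]mulrCA.
rewrite -(avgS n (fun w => g (a :: w))).
move: (avg n.+1 _) => A.
rewrite (bigD1 a)//= eqxx mul1r big1 ?addr0; last first.
  by move=> s /negbTE ->; rewrite mul0r.
by rewrite -mulrDl -[in RHS]natr1 [in RHS]mulrDl mul1r addrC.
Qed.

End word_average.

(** * Heat kernel of the simple random walk *)

Lemma bin_leq_succ n i : (i.*2 < n)%N -> ('C(n, i) <= 'C(n, i.+1))%N.
Proof.
move=> ni; have := mul_bin_left n i => e.
rewrite -(leq_pmul2l (ltn0Sn i)) e leq_mul2r; apply/orP; right; lia.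
Qed.

Lemma bin_leq_middle j i : ('C(j.*2, i) <= 'C(j.*2, j))%N.
Proof.
have half k : (k <= j)%N -> ('C(j.*2, j - k) <= 'C(j.*2, j))%N.
  elim: k => [|k ih kj]; first by rewrite subn0.
  apply: leq_trans (ih (ltnW kj)).
  have -> : (j - k = (j - k.+1).+1)%N by lia.
  by apply: bin_leq_succ; lia.
have [ij|ji] := leqP i j.
  by have := half (j - i)%N; rewrite subKn// leq_subr; exact.
have [i2j|i2j] := leqP i j.*2; last by rewrite bin_small.
rewrite -bin_sub//; have := half (i - j)%N.
have -> : (j - (i - j) = j.*2 - i)%N by lia.
by apply; lia.
Qed.

Lemma bin_middle_succ j :
  (j.+1 * 'C(j.+1.*2, j.+1) = 2 * (j.*2.+1) * 'C(j.*2, j))%N.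
Proof.
have e : 'C(j.*2.+1, j) = 'C(j.*2.+1, j.+1).
  by rewrite -bin_sub; [congr 'C(_, _); lia | lia].
rewrite doubleS binS e mulnDr -mul_bin_diag/=; move: 'C(_, _) => c; nia.
Qed.

(** Return probabilities decay like [j ^ (-1/2)], without Stirling: the induction step comes down to
    $(2j+1)(2j+3) \le 4(j+1)^2$. *)
Lemma bin_middle_sqr j : ('C(j.*2, j) ^ 2 * j.*2.+1 <= 4 ^ j.*2)%N.
Proof.
elim: j => [//|j ih].
rewrite -(@leq_pmul2l (j.+1 ^ 2)) ?expn_gt0// mulnA -expnMn bin_middle_succ.
have -> : (4 ^ j.+1.*2 = 16 * 4 ^ j.*2)%N.
  by rewrite doubleS !expnS mulnA.
apply: (@leq_trans (j.+1 ^ 2 * (16 * ('C(j.*2, j) ^ 2 * j.*2.+1)))); last first.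
  by rewrite !leq_mul2l ih !orbT.
rewrite -!mul2n; set c := 'C(_, _).
have -> : ((2 * (2 * j).+1 * c) ^ 2 * (2 * j.+1).+1 =
           (c ^ 2 * (2 * j).+1 * 4) * ((2 * j).+1 * (2 * j.+1).+1))%N by ring.
have -> : (j.+1 ^ 2 * (16 * (c ^ 2 * (2 * j).+1)) =
           (c ^ 2 * (2 * j).+1 * 4) * (4 * j.+1 ^ 2))%N by ring.
rewrite leq_mul2l; apply/orP; right; nia.
Qed.

Section heat_kernel.
Context {R : realType} {d : nat}.
Local Notation step := ('I_d * bool)%type.

Definition step_vec (s : step) : Zlattice d := (-1) ^+ s.2 *: delta_mx 0 s.1.

Definition displacement (w : seq step) : Zlattice d := \sum_(s <- w) step_vec s.

Lemma displacement_cons s w :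
  displacement (s :: w) = step_vec s + displacement w.
Proof. by rewrite /displacement big_cons. Qed.

Lemma displacement_cat u v :
  displacement (u ++ v) = displacement u + displacement v.
Proof. by rewrite /displacement big_cat. Qed.

(** Transition probability from [x] to the origin in [m] steps; by translation invariance one
    variable suffices. *)
Definition heat m (x : Zlattice d) : R :=
  avg m (fun w => (x + displacement w == 0)%:R).

(** The same kernel for the walk on the integers, given by its recursion so that it can be run for a
    random number [k] of steps. *)
Fixpoint heat1 k (y : int) : R :=
  if k is k'.+1 then (heat1 k' (y + 1) + heat1 k' (y - 1)) / 2
  else (y == 0)%:R.

Lemma heat1_support k y :
  heat1 k y != 0 -> exists i : nat, y = k%:Z - (2 * i)%N%:Z.
Proof.
elim: k y => [|k ih] y /=.
  by have [->|_] := eqVneq y 0; [exists 0%N | rewrite eqxx].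
have [h1|/ih[i yi] _] := eqVneq (heat1 k (y - 1)) 0; last first.
  by exists i; lia.
have [h2|/ih[i yi] _] := eqVneq (heat1 k (y + 1)) 0; last first.
  by exists i.+1; lia.
by rewrite h1 h2 add0r mul0r eqxx.
Qed.

Lemma heat1_bin k (i : nat) :
  heat1 k (k%:Z - (2 * i)%N%:Z) = 'C(k, i)%:R / 2 ^+ k.
Proof.
elim: k i => [|k ih] i /=.
  by case: i => [|i]; rewrite ?bin0 ?bin_small// expr0 divr1.
have -> : k.+1%:Z - (2 * i)%N%:Z - 1 = k%:Z - (2 * i)%N%:Z by lia.
rewrite ih; case: i => [|i].
  have -> : heat1 k (k.+1%:Z - (2 * 0)%N%:Z + 1) = 0.
    by apply/eqP; apply: contraT => /heat1_support[i]; lia.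
  by rewrite add0r !bin0 exprS invfM mulrAC mulrA.
have -> : k.+1%:Z - (2 * i.+1)%N%:Z + 1 = k%:Z - (2 * i)%N%:Z by lia.
by rewrite ih binS natrD exprS; field; rewrite expf_neq0.
Qed.

Lemma heat1_sqr_even j y : heat1 j.*2 y ^+ 2 * j.*2.+1%:R <= 1.
Proof.
have [->|/heat1_support[i ->]] := eqVneq (heat1 j.*2 y) 0.
  by rewrite expr0n/= mul0r.
rewrite heat1_bin expr_div_n mulrAC ler_pdivrMr ?exprn_gt0// mul1r.
rewrite -exprM mulnC exprM -!natrX -natrM ler_nat.
apply: leq_trans (bin_middle_sqr j).
by rewrite leq_mul2r leq_exp2r// bin_leq_middle orbT.
Qed.

Lemma heat1_sqr k y : heat1 k y ^+ 2 <= 2 / k.+1%:R.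
Proof.
rewrite ler_pdivlMr ?ltr0n//; rewrite -(odd_double_half k).
case: (odd k) => /=; last first.
  by rewrite add0n (le_trans (heat1_sqr_even _ _))// ler1n.
(* At odd times the kernel is the mean of two values at an even time; the factor 2 in the bound pays
   for [2 j + 2 <= 2 (2 j + 1)]. *)
set j := k./2; have h1 := heat1_sqr_even j (y + 1).
have h2 := heat1_sqr_even j (y - 1).
set a := heat1 _ (y + 1) in h1 *; set b := heat1 _ (y - 1) in h2 *.
have e : (j.*2.+2%:R : R) <= 2 * j.*2.+1%:R by rewrite -natrM ler_nat; lia.
apply: (@le_trans _ _ ((a ^+ 2 + b ^+ 2) / 2 * (2 * j.*2.+1%:R))); last by lra.
apply: ler_pM => //; first exact: sqr_ge0.
by have := sqr_ge0 (a - b); rewrite sqrrB exprMn sqrrD; lra.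
Qed.

Hypothesis d_gt0 : (0 < d)%N.

Lemma card_step : #|{: step}| = (2 * d)%N.
Proof. by rewrite card_prod card_ord card_bool mulnC. Qed.

Lemma heatS m x :
  heat m.+1 x = (2 * d)%:R^-1 * \sum_(s : step) heat m (x + step_vec s).
Proof.
rewrite /heat avgS card_step; congr (_ * _); apply: eq_bigr => s _.
by apply: eq_avg => w _; rewrite displacement_cons addrA.
Qed.

(* Given which coordinate moves at each step, the coordinates perform
   independent one-dimensional walks. *)
Lemma heat_coord m x :
  heat m x =
  avg m (fun c : seq 'I_d => \prod_i heat1 (count_mem i c) (x 0 i)).
Proof.
elim: m x => [|m ih] x.
  rewrite /heat/= /displacement big_nil addr0.
  have [->|x0] := eqVneq x 0; first by rewrite big1// => i _; rewrite mxE.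
  have /existsP[i xi] : [exists i, x 0 i != 0].
    apply: contraNT x0; rewrite negb_exists => /forallP x0.
    by apply/eqP/rowP => i; rewrite mxE; apply/eqP; rewrite -[_ == _]negbK.
  by rewrite (bigD1 i)//= (negbTE xi) mul0r.
rewrite heatS avgS card_ord natrM invfM mulrAC [RHS]mulrC; congr (_ * _).
rewrite -(pair_big xpredT xpredT (fun i b => heat m (x + step_vec (i, b))))/=.
rewrite mulr_sumr; apply: eq_bigr => i _.
rewrite big_bool/= !ih -avgD -avgZ; apply: eq_avg => c _.
(* Only coordinate [i] moves: its factor follows the recursion of [heat1] and the other factors are
   unchanged. *)
rewrite (bigD1 i)//= [X in _ + X](bigD1 i)//= [RHS](bigD1 i)//= eqxx.
have off b j : j != i -> (x + step_vec (i, b)) 0 j = x 0 j.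
  by move=> ji; rewrite !mxE/= (negbTE ji) ?andbF mulr0 addr0.
have -> : (x + step_vec (i, true)) 0 i = x 0 i - 1.
  by rewrite !mxE/= !eqxx mulr1 expr1.
have -> : (x + step_vec (i, false)) 0 i = x 0 i + 1.
  by rewrite !mxE/= !eqxx mulr1 expr0.
rewrite (eq_bigr (fun j => heat1 (count_mem j c) (x 0 j))); last first.
  by move=> j ji; rewrite off.
rewrite [X in _ + _ * X](eq_bigr (fun j => heat1 (count_mem j c) (x 0 j))); last first.
  by move=> j ji; rewrite off.
rewrite [RHS](_ : _ = (heat1 (count_mem i c) (x 0 i + 1) +
    heat1 (count_mem i c) (x 0 i - 1)) / 2 *
    \prod_(j | j != i) heat1 (count_mem j c) (x 0 j)); last first.
  congr (_ * _); apply: eq_bigr => j /negbTE ji.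
  by rewrite eq_sym ji.
ring.
Qed.

Lemma avg_prod_inv (r : seq 'I_d) m : uniq r ->
  avg m (fun c : seq 'I_d => \prod_(i <- r) (count_mem i c).+1%:R^-1) <=
  (d%:R / m.+1%:R) ^+ size r :> R.
Proof.
have cd : (0 < #|'I_d|)%N by rewrite card_ord.
elim: r m => [|a r ih] m /=.
  by move=> _; under eq_avg do rewrite big_nil; rewrite avg_cst.
case/andP => ar ur.
(* Inserting a letter [a] turns the first factor into the wanted [1 / (k_a + 1)], whereas weighting
   by [k_a] cancels it and leaves the product over [r]. *)
pose g c : R := (count_mem a c)%:R^-1 * \prod_(i <- r) (count_mem i c).+1%:R^-1.
have gP u v : perm_eq u v -> g u = g v.
  move=> uv; rewrite /g (permP uv); congr (_ * _).
  by apply: eq_bigr => i _; rewrite (permP uv).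
have := avg_count_bias m a gP; rewrite card_ord.
have -> : avg m (fun c => g (a :: c)) =
    avg m (fun c : seq 'I_d => \prod_(i <- a :: r) (count_mem i c).+1%:R^-1).
  apply: eq_avg => c _; rewrite /g/= eqxx add1n big_cons; congr (_ * _).
  apply: eq_big_seq => i ri; rewrite (_ : (a == i) = false)//.
  by apply: contraNF ar => /eqP ->.
move=> bias; rewrite exprS -ler_pdivrMl ?divr_gt0 ?ltr0n// invf_div -bias.
have step : avg m.+1 (fun c => (count_mem a c)%:R * g c) <=
    avg m.+1 (fun c : seq 'I_d => \prod_(i <- r) (count_mem i c).+1%:R^-1).
  apply: le_avg => c _; rewrite /g mulrA ler_piMl ?prodr_ge0//.
  by case: (count_mem a c) => [|k]; rewrite ?mul0r// mulfV// pnatr_eq0.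
apply: (le_trans step); apply: (le_trans (ih _ ur)).
rewrite lerXn2r ?nnegrE ?divr_ge0// ler_pM2l ?ltr0n//.
by rewrite lef_pV2 ?posrE ?ltr0n// ler_nat ltnS.
Qed.

Lemma heat_ge0 m x : 0 <= heat m x.
Proof. exact: avg_ge0. Qed.

(* By Cauchy-Schwarz the bound sqrt(2 / (k + 1)) on each one-dimensional walk
   reduces to E prod_i 1 / (k_i + 1) for multinomial (k_i), which size biasing
   evaluates. *)
Lemma heat_sqr_le m x : heat m x ^+ 2 <= ((2 * d)%:R / m.+1%:R) ^+ d.
Proof.
have cd : (0 < #|'I_d|)%N by rewrite card_ord.
rewrite heat_coord; apply: le_trans (sqr_avg_le cd _ _) _.
apply: (@le_trans _ _ (2 ^+ d * avg m (fun c : seq 'I_d =>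
    \prod_(i <- index_enum 'I_d) (count_mem i c).+1%:R^-1))).
  rewrite -avgZ; apply: le_avg => c _; rewrite -prodrXl.
  have -> : 2 ^+ d = \prod_(i < d) (2 : R) by rewrite prodr_const card_ord.
  rewrite -big_split/=; apply: ler_prod => i _.
  by rewrite sqr_ge0 heat1_sqr.
have sz : size (index_enum 'I_d) = d by rewrite -sum1_size sum1_card card_ord.
have := avg_prod_inv m (index_enum_uniq 'I_d); rewrite sz.
by move=> h; rewrite natrM -mulrA [leRHS]exprMn ler_pM2l ?exprn_gt0.
Qed.

(** The exponent may be lowered at will, so that one exponent below 3 serves all dimensions from 6
    on. *)
Lemma heat_npow_le (a : R) m x : a <= d%:R / 2 ->
  heat m x <= Num.sqrt ((2 * d)%:R ^+ d) * npow m (- a).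
Proof.
move=> ad; rewrite -(ger0_norm (heat_ge0 m x)) -sqrtr_sqr.
apply: (@le_trans _ _ (Num.sqrt (((2 * d)%:R / m.+1%:R) ^+ d))).
  by rewrite ler_wsqrtr// heat_sqr_le.
rewrite expr_div_n sqrtrM ?exprn_ge0// ler_wpM2l ?sqrtr_ge0//.
apply: (@le_trans _ _ (npow m (- (d%:R / 2)))); last first.
  by apply: npow_le_expo; rewrite lerN2.
rewrite /npow powRN powRrM powR12_sqrt ?powR_ge0// powR_mulrn//.
by rewrite sqrtrV ?exprn_ge0.
Qed.

End heat_kernel.

(** * Semigroup property and products of three kernels *)

Section heat_semigroup.
Context {R : realType} {d : nat}.
Local Notation step := ('I_d * bool)%type.
Local Notation heat := (@heat R d).
Local Notation D := displacement.

Lemma heatN m x : heat m (- x) = heat m x.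
Proof.
elim: m x => [|m ih] x.
  by rewrite /heat/= /D big_nil !addr0 oppr_eq0.
have flipK : involutive (fun s : step => (s.1, ~~ s.2)).
  by case=> i b; rewrite /= negbK.
rewrite !heatS (reindex_inj (inv_inj flipK)); congr (_ * _).
apply: eq_bigr => -[i b] _; rewrite -ih opprD opprK; congr (heat _ (_ + _)).
by rewrite /step_vec/= signrN scaleNr opprK.
Qed.

(** Markov property at time [m] (Chapman-Kolmogorov). *)
Lemma avg_heat m l x : avg m (fun w => heat l (x + D w)) = heat (m + l) x.
Proof.
rewrite [RHS](avg_cat m l); apply: eq_avg => u _; apply: eq_avg => v _.
by rewrite displacement_cat addrA.
Qed.

(** The probability that three independent walks from the origin, at times [m], [a] and [b], are at
    the same site; hence the symmetry in the three times. *)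
Definition heat3 m a b : R := avg m (fun w => heat a (D w) * heat b (D w)).

Lemma heat3C m a b : heat3 m a b = heat3 m b a.
Proof. by apply: eq_avg => w _; rewrite mulrC. Qed.

Lemma heat3CA m a b : heat3 m a b = heat3 a m b.
Proof.
have e n c : heat3 n c b =
    avg n (fun w => avg c (fun u => (D w + D u == 0)%:R * heat b (D w))).
  by apply: eq_avg => w _; rewrite avgZr.
rewrite !e avg_avgC; apply: eq_avg => u _; apply: eq_avg => w _.
(* The indicator forces the two displacements to be opposite, and the kernel is even. *)
rewrite addrC; case: eqP => [/eqP|_]; rewrite ?mul0r// addr_eq0 => /eqP ->.
by rewrite heatN.
Qed.

(** The kernel of time [a] is bounded uniformly; the other two merge into one walk of [m + b]
    steps. *)
Lemma heat3_le K alpha m a b : (forall n x, heat n x <= K * npow n (- alpha)) ->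
  heat3 m a b <= K ^+ 2 * (npow a (- alpha) * npow (m + b) (- alpha)).
Proof.
move=> hK; apply: (@le_trans _ _ (K * npow a (- alpha) * heat (m + b) 0)).
  rewrite -avg_heat -avgZ; apply: le_avg => w _; rewrite add0r.
  by rewrite ler_wpM2r ?heat_ge0.
rewrite expr2 mulrACA ler_wpM2l// mulr_ge0 ?npow_ge0//.
by rewrite -(pmulr_lge0 _ (npow_gt0 0 (- alpha))) (le_trans _ (hK 0%N 0)) ?heat_ge0.
Qed.

End heat_semigroup.

Definition tail_cst {R : realType} (s : R) : R := 1 + (s - 1)^-1.

Lemma tail_cst_gt0 {R : realType} (s : R) : 1 < s -> 0 < tail_cst s.
Proof. by move=> s1; rewrite addr_gt0// invr_gt0; lra. Qed.

Lemma tail_cst_ge0 {R : realType} (s : R) : 1 < s -> 0 <= tail_cst s.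
Proof. by move=> s1; exact/ltW/tail_cst_gt0. Qed.

Lemma sum_npow_shift {R : realType} (s : R) m N : 1 < s ->
  \sum_(k < N) npow (m + k) (- s) <= tail_cst s * npow m (1 - s).
Proof.
move=> s1; apply: le_trans (sum_npow_tail m (m + N) s1).
rewrite [leRHS](_ : _ = \sum_(k < N) npow (m + k) (- s))//.
rewrite -{1}[m]add0n big_addn addKn big_mkord.
by apply: eq_bigr => k _; rewrite addnC.
Qed.

Lemma sum_npow_from {R : realType} (s : R) m N : 1 < s ->
  \sum_(k < N | (m <= k)%N) npow k (- s) <= tail_cst s * npow m (1 - s).
Proof.
move=> s1; apply: le_trans (sum_npow_tail m N s1).
by rewrite [leRHS]big_geq_mkord.
Qed.

Lemma sum_ord_cond_le {R : realType} (f : nat -> R) N n :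
  (forall k, 0 <= f k) -> \sum_(b < N | (b < n)%N) f b <= \sum_(k < n) f k.
Proof.
move=> f0; have [nN|/ltnW Nn] := leqP n N; first by rewrite (big_ord_widen N f).
rewrite (big_ord_widen_cond n (fun b => b < n)%N f Nn) big_mkcond ler_sum// => b _.
by case: ifP.
Qed.

(* [heat3 m a b] is controlled by the largest of its three times, since the
   other two can be merged by the Markov property. *)
Section heat3_sum.
Context {R : realType} {d : nat} (K alpha : R).
Hypothesis alpha_ge : 5 / 2 <= alpha.
Hypothesis alpha_lt : alpha < 3.
Hypothesis heatK : forall n (x : Zlattice d), heat n x <= K * npow n (- alpha).
Local Notation heat3 := (@heat3 R d).

Definition heat3_cst : R :=
  K ^+ 2 * (tail_cst alpha * tail_cst (alpha - 1) * 2 +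
            tail_cst alpha * (2 / (3 - alpha))).

Lemma sum_heat3_le m A B :
  \sum_(a < A) \sum_(b < B) b.+1%:R * heat3 m a b <=
  heat3_cst * npow m (3 - 2 * alpha).
Proof.
have ha := alpha_ge; have hb := alpha_lt.
have s1 : 1 < alpha by lra.
have s2 : 1 < alpha - 1 by lra.
have K2 : 0 <= K ^+ 2 by exact: sqr_ge0.
(* One bound per regime: [m <= a], [m <= b], and both below [m]. The kernel bounded uniformly is
   that of time [a], [b] and [m] respectively; in the first two the weight [b + 1] raises one
   exponent by 1. *)
pose t1 a b : R := (m <= a)%:R * npow a (- alpha) * npow (m + b) (- (alpha - 1)).
pose t2 a b : R := npow (m + a) (- alpha) * ((m <= b)%:R * npow b (- (alpha - 1))).
pose t3 a b : R := (b < m.+1)%:R *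
  (npow m (- alpha) * (b.+1%:R * npow (b + a) (- alpha))).
have npow1B k : npow k (- (alpha - 1)) = k.+1%:R * npow k (- alpha) :> R.
  by rewrite -npow1 -npowD; congr npow; lra.
have le3 a b : b.+1%:R * heat3 m a b <= K ^+ 2 * (t1 a b + t2 a b + t3 a b).
  have [t1p t2p t3p] : [/\ 0 <= t1 a b, 0 <= t2 a b & 0 <= t3 a b].
    by split; rewrite ?mulr_ge0 ?npow_ge0 ?ler0n.
  have [ma|am] := leqP m a.
    apply: (@le_trans _ _ (K ^+ 2 * t1 a b)); last by rewrite ler_wpM2l//; lra.
    rewrite mulrC -ler_pdivlMr ?ltr0n//.
    apply: le_trans (heat3_le m a b heatK) _.
    rewrite -[leRHS]mulrA ler_wpM2l// /t1 ma mul1r npow1B ler_pdivlMr ?ltr0n//.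
    rewrite -mulrA ler_wpM2l ?npow_ge0// mulrC ler_wpM2r ?npow_ge0//.
    by rewrite ler_nat; lia.
  have [mb|bm] := leqP m b.
    apply: (@le_trans _ _ (K ^+ 2 * t2 a b)); last by rewrite ler_wpM2l//; lra.
    rewrite heat3C mulrC -ler_pdivlMr ?ltr0n//.
    apply: le_trans (heat3_le m b a heatK) _.
    rewrite -[leRHS]mulrA ler_wpM2l// /t2 mb mul1r npow1B ler_pdivlMr ?ltr0n//.
    by rewrite le_eqVlt; apply/orP; left; apply/eqP; ring.
  apply: (@le_trans _ _ (K ^+ 2 * t3 a b)); last by rewrite ler_wpM2l//; lra.
  rewrite heat3CA mulrC -ler_pdivlMr ?ltr0n//.
  apply: le_trans (heat3_le a m b heatK) _.
  rewrite -[leRHS]mulrA ler_wpM2l// /t3 ltnS (ltnW bm) mul1r ler_pdivlMr ?ltr0n//.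
  by rewrite addnC le_eqVlt; apply/orP; left; apply/eqP; ring.
apply: (@le_trans _ _ (\sum_(a < A) \sum_(b < B)
    (K ^+ 2 * (t1 a b + t2 a b + t3 a b)))).
  by apply: ler_sum => a _; apply: ler_sum => b _; exact: le3.
under eq_bigr do rewrite -mulr_sumr.
rewrite -mulr_sumr /heat3_cst -mulrA ler_wpM2l//.
under eq_bigr do rewrite !big_split/=.
rewrite !big_split/= mulrDl; apply: lerD.
  have s3 : npow m (3 - 2 * alpha) = npow m (1 - alpha) * npow m (1 - (alpha - 1)) :> R.
    by rewrite -npowD; congr npow; lra.
  have hA : \sum_(a < A) (m <= a)%:R * npow a (- alpha) <=
      tail_cst alpha * npow m (1 - alpha).
    apply: le_trans (sum_npow_from m A s1).
    rewrite [leRHS]big_mkcond ler_sum// => a _.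
    by case: leqP; rewrite ?mul1r ?mul0r.
  have hB : \sum_(b < B) (m <= b)%:R * npow b (- (alpha - 1)) <=
      tail_cst (alpha - 1) * npow m (1 - (alpha - 1)).
    apply: le_trans (sum_npow_from m B s2).
    rewrite [leRHS]big_mkcond ler_sum// => b _.
    by case: leqP; rewrite ?mul1r ?mul0r.
  have hA' := sum_npow_shift m A s1; have hB' := sum_npow_shift m B s2.
  rewrite mulr_natr mulr2n mulrDl s3; apply: lerD.
    rewrite mulrACA; under eq_bigr do rewrite -mulr_sumr.
    rewrite -mulr_suml; apply: ler_pM => //; apply: sumr_ge0 => i _;
      by rewrite ?mulr_ge0 ?npow_ge0 ?ler0n.
  rewrite mulrACA; under eq_bigr do rewrite -mulr_sumr.
  rewrite -mulr_suml; apply: ler_pM => //; apply: sumr_ge0 => i _;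
    by rewrite ?mulr_ge0 ?npow_ge0 ?ler0n.
have s3 : npow m (3 - 2 * alpha) = npow m (- alpha) * npow m (3 - alpha) :> R.
  by rewrite -npowD; congr npow; lra.
rewrite exchange_big/= s3.
have c0 := tail_cst_ge0 s1.
(* Summing over [a] first and including the weight leaves [(b + 1) ^ (2 - alpha)], whose sum up to
   [m] is of order [(m + 1) ^ (3 - alpha)] since [alpha < 3]. *)
apply: (@le_trans _ _ (\sum_(b < B) (b < m.+1)%:R * (npow m (- alpha) *
    (tail_cst alpha * npow b (- (alpha - 2)))))).
  apply: ler_sum => b _; rewrite -mulr_sumr ler_wpM2l ?ler0n//.
  rewrite -mulr_sumr ler_wpM2l ?npow_ge0// -mulr_sumr.
  rewrite -ler_pdivlMl ?ltr0n//; apply: le_trans (sum_npow_shift b A s1) _.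
  rewrite mulrCA ler_wpM2l// -npow1 -powR_inv1 ?npow_ge0//.
  rewrite [X in _ <= X * _](_ : _ = npow b (-1)); last first.
    by rewrite /npow powRr1// powR_inv1.
  by rewrite -npowD; apply: npow_le_expo; lra.
rewrite (eq_bigr (fun b : 'I_B => npow m (- alpha) * tail_cst alpha *
   ((b < m.+1)%:R * npow b (- (alpha - 2))))); last by move=> b _; ring.
rewrite -mulr_sumr [leRHS](_ : _ = npow m (- alpha) * tail_cst alpha *
  (2 / (3 - alpha) * npow m (3 - alpha))); last by ring.
rewrite ler_wpM2l ?mulr_ge0 ?npow_ge0//.
have h := @sum_npow_head R (alpha - 2) m.
have -> : 3 - alpha = 1 - (alpha - 2) by lra.
apply: le_trans (h _ _); [|by lra|by lra].
rewrite (eq_bigr (fun b : 'I_B =>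
    if (b < m.+1)%N then npow b (- (alpha - 2)) else 0)); last first.
  by move=> b _; case: ifP; rewrite ?mul1r ?mul0r.
rewrite -big_mkcond/=.
by apply: (@sum_ord_cond_le _ (fun b => npow b (- (alpha - 2)))) => k; exact: npow_ge0.
Qed.

End heat3_sum.

(** * Second moment of the overlap *)

Lemma sum_shift {R : realType} (f : nat -> R) m n :
  \sum_(m <= k < n) f k = \sum_(k < n - m) f (m + k)%N.
Proof.
rewrite -{1}[m]add0n big_addn big_mkord.
by apply: eq_bigr => k _; rewrite addnC.
Qed.

(** A number [b] is of the form [l + c] for at most [b + 1] values of [l]. This is the origin of the
    weight in [sum_heat3_le]. *)
Lemma sum_diag_le {R : realType} (f : nat -> R) L C : (forall k, 0 <= f k) ->
  \sum_(l < L) \sum_(c < C) f (l + c)%N <= \sum_(b < L + C) b.+1%:R * f b.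
Proof.
move=> f0.
apply: (@le_trans _ _ (\sum_(l < L) \sum_(b < L + C) (l <= b)%:R * f b)).
  apply: ler_sum => l _.
  rewrite (eq_bigr (fun b : 'I_(L + C) => if (l <= b)%N then f b else 0)); last first.
    by move=> b _; case: leqP; rewrite ?mul1r ?mul0r.
  rewrite -big_mkcond/=.
  rewrite (_ : \sum_(b < L + C | _) _ = \sum_(l <= b < L + C) f b); last first.
    by rewrite big_geq_mkord.
  have lC : (C <= L + C - l)%N by have := ltn_ord l; lia.
  rewrite sum_shift (big_ord_widen _ (fun c => f (l + c)%N) lC).
  by rewrite big_mkcond ler_sum// => c _; case: ifP.
rewrite exchange_big ler_sum// => b _; rewrite -mulr_suml ler_wpM2r//.
have := @sum_ord_cond_le R (fun=> 1) L b.+1 (fun=> ler01).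
rewrite [X in _ <= X]sumr_const card_ord; apply: le_trans; rewrite [leRHS]big_mkcond.
by apply: ler_sum => l _; rewrite ltnS; case: leqP.
Qed.

(** Orders the two indices of the square, so that the path can later be split at the larger one. *)
Lemma sqr_sum_le {R : realType} (f : nat -> R) N : (forall k, 0 <= f k) ->
  (\sum_(i < N) f i) ^+ 2 <= 2 * \sum_(k < N) \sum_(i < k.+1) f k * f i.
Proof.
move=> f0; elim: N => [|N ih]; first by rewrite !big_ord0 expr0n mulr0.
rewrite big_ord_recr/= [in leRHS]big_ord_recr/= sqrrD mulrDr -mulr_sumr.
rewrite [in leRHS]big_ord_recr/=; set S := \sum_(i < N) f i in ih *.
by have := sqr_ge0 (f N); rewrite -mulr_natr; lra.
Qed.

(** * Triangle inequality in mean square *)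

Section minkowski.
Context {R : realType} {T : finType}.

(** Pointwise $(f+g)^2 \le (1+b/a) f^2 + (1+a/b) g^2$, the difference being $(bf-ag)^2/(ab)$. *)
Lemma avg_sqrD_le n (f g : seq T -> R) a b : 0 < a -> 0 < b ->
  avg n (fun w => f w ^+ 2) <= a ^+ 2 -> avg n (fun w => g w ^+ 2) <= b ^+ 2 ->
  avg n (fun w => (f w + g w) ^+ 2) <= (a + b) ^+ 2.
Proof.
move=> a0 b0 fa gb.
apply: (@le_trans _ _ ((1 + b / a) * avg n (fun w => f w ^+ 2) +
                       (1 + a / b) * avg n (fun w => g w ^+ 2))).
  rewrite -!avgZ -avgD; apply: le_avg => w _; rewrite -subr_ge0.
  rewrite [leRHS](_ : _ = (b * f w - a * g w) ^+ 2 / (a * b)); last by field; lra.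
  by rewrite divr_ge0 ?sqr_ge0// mulr_ge0// ltW.
have -> : (a + b) ^+ 2 = (1 + b / a) * a ^+ 2 + (1 + a / b) * b ^+ 2.
  by field; lra.
by apply: lerD; rewrite ler_wpM2l// addr_ge0// divr_ge0// ltW.
Qed.

Lemma avg_sqr_sum_le n (f : nat -> seq T -> R) (c : nat -> R) N :
  (forall r, 0 < c r) ->
  (forall r, (r <= N)%N -> avg n (fun w => f r w ^+ 2) <= c r ^+ 2) ->
  avg n (fun w => (\sum_(r < N.+1) f r w) ^+ 2) <= (\sum_(r < N.+1) c r) ^+ 2.
Proof.
move=> c0; elim: N => [|N ih] fc.
  by under eq_avg do rewrite big_ord1; rewrite big_ord1 fc.
under eq_avg do rewrite big_ord_recr/=; rewrite [in leRHS]big_ord_recr/=.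
apply: avg_sqrD_le => //; last exact: fc.
  by rewrite big_ord_recl ltr_pwDl// sumr_ge0// => i _; exact: ltW.
by apply: ih => r rN; apply: fc; exact: leqW.
Qed.

End minkowski.

(** * Increments of the walk and the truncated Green function *)

Section segments.
Context {R : realType} {d : nat}.
Hypothesis d_gt0 : (0 < d)%N.
Local Notation step := ('I_d * bool)%type.
Local Notation D := (@displacement d).

Definition segment i j (w : seq step) : Zlattice d := D (take j w) - D (take i w).

Lemma segmentD i k j w : segment i j w = segment i k w + segment k j w.
Proof. by rewrite addrC /segment subrKA. Qed.

(** Increments over consecutive time intervals are independent and stationary. *)
Lemma avg_segment n i k j (f : Zlattice d -> Zlattice d -> R) :
  (i <= k)%N -> (k <= j)%N -> (j <= n)%N ->
  avg n (fun w => f (segment i k w) (segment k j w)) =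
  avg (k - i) (fun u => avg (j - k) (fun v => f (D u) (D v))).
Proof.
move=> ik kj jn.
have ct : (0 < #|{: step}|)%N by rewrite card_step muln_gt0.
have -> : (n = i + ((k - i) + ((j - k) + (n - j))))%N by lia.
rewrite avg_cat -[RHS](avg_cst ct i); apply: eq_avg => t st.
rewrite avg_cat; apply: eq_avg => u su.
rewrite avg_cat; apply: eq_avg => v sv.
rewrite -[RHS](avg_cst ct (n - j)); apply: eq_avg => z sz.
have ti : take i (t ++ u ++ v ++ z) = t by rewrite take_size_cat.
have tk : take k (t ++ u ++ v ++ z) = t ++ u.
  by rewrite catA take_size_cat// size_cat st su subnKC.
have tj : take j (t ++ u ++ v ++ z) = t ++ u ++ v.
  by rewrite !catA take_size_cat// !size_cat st su sv; lia.
rewrite /segment ti tk tj !displacement_cat.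
congr (f _ _); first by rewrite addrC addKr.
by apply: (canLR (addrK _)); rewrite addrA addrC.
Qed.

(** Green function truncated at time [M]; the second moment bounds below are uniform in [M]. *)
Definition green M (x : Zlattice d) : R := \sum_(j < M.+1) heat j x.

Lemma green_ge0 M x : 0 <= green M x.
Proof. by apply: sumr_ge0 => j _; exact: heat_ge0. Qed.

Lemma avg_green l M x :
  avg l (fun w => green M (x + D w)) = \sum_(c < M.+1) heat (l + c) x.
Proof. by rewrite avg_sum; apply: eq_bigr => c _; rewrite avg_heat. Qed.

End segments.

Section second_moment.
Context {R : realType} {d : nat} (K alpha : R).
Hypothesis d_gt0 : (0 < d)%N.
Hypothesis alpha_ge : 5 / 2 <= alpha.
Hypothesis alpha_lt : alpha < 3.
Hypothesis heatK : forall n (x : Zlattice d), heat n x <= K * npow n (- alpha).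
Local Notation step := ('I_d * bool)%type.
Local Notation D := (@displacement d).
Local Notation green := (@green R d).

Lemma heat3_cst_gt0 : 0 < heat3_cst K alpha.
Proof.
have ha := alpha_ge; have hb := alpha_lt.
(* The kernel at time 0 takes the value 1 at the origin, which forces [1 <= K]. *)
have K0 : 0 < K.
  rewrite (lt_le_trans ltr01)//; have := heatK 0 0.
  by rewrite /heat/= /displacement big_nil addr0 eqxx /npow powR1 mulr1.
rewrite mulr_gt0 ?exprn_gt0// addr_gt0// !mulr_gt0//.
- by apply: tail_cst_gt0; lra.
- by apply: tail_cst_gt0; lra.
- by apply: tail_cst_gt0; lra.
- by rewrite invr_gt0; lra.
Qed.

(** The later time [j = a + 1 + r] is fixed and the earlier times [i <= k <= a] vary. Splitting the
    path at [k] turns the products of Green functions into sums of [heat3] with first time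
    [j - k >= r + 1]. *)
Lemma avg_green_col_sqr_le M n a r : (a.+1 + r <= n)%N ->
  avg n (fun w => (\sum_(i < a.+1) green M (segment i (a.+1 + r) w)) ^+ 2) <=
  2 * heat3_cst K alpha * tail_cst (2 * alpha - 3) * npow r (4 - 2 * alpha).
Proof.
have ha := alpha_ge; have hb := alpha_lt.
set j := (a.+1 + r)%N => jn.
apply: (@le_trans _ _ (2 * \sum_(k < a.+1) \sum_(i < k.+1)
    avg n (fun w => green M (segment k j w) * green M (segment i j w)))).
  under eq_bigr do rewrite -avg_sum.
  rewrite -avg_sum -avgZ; apply: le_avg => w _.
  by apply: (@sqr_sum_le _ (fun i => green M (segment i j w))) => k; exact: green_ge0.
rewrite -2!mulrA ler_pM2l//.
apply: (@le_trans _ _ (\sum_(k < a.+1) heat3_cst K alpha *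
    npow (j - k) (- (2 * alpha - 3)))).
  apply: ler_sum => k _.
  have -> : - (2 * alpha - 3) = 3 - 2 * alpha by lra.
  have kj : (k <= j)%N by have := ltn_ord k; rewrite /j; lia.
  apply: le_trans (sum_heat3_le alpha_ge alpha_lt heatK (j - k) M.+1 (k.+1 + M.+1)).
  (* Given the increment from [k] to [j], averaging the one from [i] to [k] shifts the times in the
     second Green function by [k - i]. *)
  rewrite (eq_bigr (fun i : 'I_k.+1 => avg (j - k) (fun v => green M (D v) *
      \sum_(c < M.+1) heat ((k - i) + c) (D v)))); last first.
    move=> i _; have ik : (i <= k)%N by rewrite -ltnS.
    under eq_avg do rewrite (segmentD i k j).
    rewrite (avg_segment d_gt0 (fun x y => green M y * green M (x + y)) ik kj jn).
    rewrite avg_avgC; apply: eq_avg => v _.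
    by rewrite avgZ -avg_green; congr (_ * _); apply: eq_avg => u _; rewrite addrC.
  rewrite /heat3; under [leRHS]eq_bigr do under eq_bigr do rewrite -avgZ.
  under [leRHS]eq_bigr do rewrite -avg_sum.
  rewrite -!avg_sum; apply: le_avg => v _.
  rewrite -mulr_sumr (reindex_inj rev_ord_inj)/=.
  rewrite (eq_bigr (fun i : 'I_k.+1 => \sum_(c < M.+1) heat (i + c) (D v))); last first.
    move=> i _; apply: eq_bigr => c _; congr (heat (_ + _) _).
    by have := ltn_ord i; lia.
  rewrite /green mulr_suml ler_sum// => b _.
  apply: le_trans (ler_wpM2l (heat_ge0 _ _)
    (sum_diag_le k.+1 M.+1 (fun l => heat_ge0 l (D v)))) _.
  rewrite mulr_sumr le_eqVlt; apply/orP; left; apply/eqP.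
  by apply: eq_bigr => c _; rewrite mulrCA.
rewrite -mulr_sumr ler_pM2l ?heat3_cst_gt0//.
have s1 : 1 < 2 * alpha - 3 by lra.
have -> : 4 - 2 * alpha = 1 - (2 * alpha - 3) by lra.
apply: (@le_trans _ _ (tail_cst (2 * alpha - 3) *
    npow r.+1 (1 - (2 * alpha - 3)))); last first.
  by rewrite ler_wpM2l ?tail_cst_ge0// npow_le//; lra.
apply: le_trans (sum_npow_shift r.+1 a.+1 s1).
rewrite (reindex_inj rev_ord_inj)/=; apply: ler_sum => k _.
rewrite (_ : (j - _)%N = (r.+1 + k)%N)//.
by have := ltn_ord k; rewrite /j; lia.
Qed.

Definition moment_cst : R :=
  Num.sqrt (2 * heat3_cst K alpha * tail_cst (2 * alpha - 3)) * (2 / (3 - alpha)).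

Lemma moment_cst_gt0 : 0 < moment_cst.
Proof.
have ha := alpha_ge; have hb := alpha_lt.
rewrite mulr_gt0// ?divr_gt0//; last by lra.
rewrite sqrtr_gt0 (mulr_gt0 (mulr_gt0 _ heat3_cst_gt0))//.
by apply: tail_cst_gt0; lra.
Qed.

Lemma avg_green_sqr_le M a b :
  avg (a.+1 + b) (fun w =>
    (\sum_(r < b.+1) \sum_(i < a.+1) green M (segment i (a.+1 + r) w)) ^+ 2) <=
  (moment_cst * npow b (3 - alpha)) ^+ 2.
Proof.
have ha := alpha_ge; have hb := alpha_lt.
set C := 2 * heat3_cst K alpha * tail_cst (2 * alpha - 3).
have C0 : 0 < C.
  rewrite (mulr_gt0 (mulr_gt0 _ heat3_cst_gt0))//.
  by apply: tail_cst_gt0; lra.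
pose c r : R := Num.sqrt C * npow r (- (alpha - 2)).
have c0 r : 0 < c r by rewrite mulr_gt0 ?npow_gt0 ?sqrtr_gt0.
apply: (@le_trans _ _ ((\sum_(r < b.+1) c r) ^+ 2)).
  apply: (avg_sqr_sum_le (f := fun r w =>
    \sum_(i < a.+1) green M (segment i (a.+1 + r) w))) => // r rb.
  have rn : (a.+1 + r <= a.+1 + b)%N by rewrite leq_add2l.
  apply: le_trans (avg_green_col_sqr_le M rn) _.
  rewrite -/C /c exprMn sqr_sqrtr ?(ltW C0)// ler_pM2l// expr2 -npowD.
  by apply: npow_le_expo; lra.
have c1 : 0 <= \sum_(r < b.+1) c r by apply: sumr_ge0 => r _; exact: ltW.
have m0 : 0 <= moment_cst * npow b (3 - alpha).
  by rewrite mulr_ge0 ?npow_ge0 ?ltW ?moment_cst_gt0.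
rewrite lerXn2r ?nnegrE// -mulr_sumr -mulrA ler_pM2l ?sqrtr_gt0//.
have -> : 3 - alpha = 1 - (alpha - 2) by lra.
by apply: sum_npow_head; lra.
Qed.

End second_moment.

(** * Truncated capacity *)

Lemma ler_sum_mem {R : realType} (I : eqType) (r : seq I) (f : I -> R) i :
  (forall j, 0 <= f j) -> i \in r -> f i <= \sum_(j <- r) f j.
Proof.
by move=> f0 ir; rewrite (big_rem _ ir)/= lerDl sumr_ge0.
Qed.

Lemma ler_sum_undup {R : realType} (I : eqType) (r : seq I) (f : I -> R) :
  (forall j, 0 <= f j) -> \sum_(j <- undup r) f j <= \sum_(j <- r) f j.
Proof.
move=> f0; elim: r => [|i r ih]; first by rewrite !big_nil.
by rewrite big_cons/=; case: ifP => _; rewrite ?big_cons ?lerD2l//; exact: ler_wpDl.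
Qed.

Lemma sum_iota {R : realType} n (f : nat -> R) :
  \sum_(k <- iota 0 n) f k = \sum_(k < n) f k.
Proof. by rewrite -(big_mkord xpredT f) /index_iota subn0. Qed.

Section truncated_capacity.
Context {R : realType} {d : nat}.
Hypothesis d_gt0 : (0 < d)%N.
Local Notation step := ('I_d * bool)%type.
Local Notation D := (@displacement d).
Local Notation V := (Zlattice d).
Implicit Types (A B : seq V) (x y z : V) (M : nat).

Definition avoids M A x (w : seq step) : bool :=
  all (fun k => x + D (take k w) \notin A) (iota 1 M).

Definition escape M A x : R := avg M (fun w => (avoids M A x w)%:R).

Lemma avoids_sub M A B x w :
  {subset A <= B} -> avoids M B x w -> avoids M A x w.
Proof.
by move=> AB; apply: sub_all => k; apply: contra; exact: AB.
Qed.

Lemma escape_ge0 M A x : 0 <= escape M A x.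
Proof. by apply: avg_ge0 => w _; exact: ler0n. Qed.

Lemma escape_le1 M A x : escape M A x <= 1.
Proof.
have ct : (0 < #|{: step}|)%N by rewrite card_step muln_gt0.
by rewrite -(avg_cst ct M 1); apply: le_avg => w _; rewrite lern1 leq_b1.
Qed.

Lemma escape_sub M A B x : {subset A <= B} -> escape M B x <= escape M A x.
Proof.
move=> AB; apply: le_avg => w _; rewrite ler_nat.
by case: (boolP (avoids M B x w)) => // /(avoids_sub AB) ->.
Qed.

Lemma escape_translate M A x z :
  escape M [seq z + y | y <- A] (z + x) = escape M A x.
Proof.
apply: eq_avg => w _; congr (nat_of_bool _)%:R; apply: eq_all => k.
by rewrite -addrA mem_map//; exact: addrI.
Qed.

Lemma avg_take_heat M j x : (j <= M)%N ->
  avg M (fun w : seq step => (x + D (take j w) == 0)%:R) = heat j x :> R.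
Proof.
have ct : (0 < #|{: step}|)%N by rewrite card_step muln_gt0.
move=> jM; rewrite -(subnKC jM) avg_cat; apply: eq_avg => u su.
rewrite -[RHS](avg_cst ct (M - j)); apply: eq_avg => v _.
by rewrite take_size_cat.
Qed.

(** Union bound over the sites of [B] and the times at which they are hit. *)
Lemma escape_diff_le M A B x :
  escape M A x - escape M (A ++ B) x <=
  \sum_(y <- B) \sum_(j < M) heat j.+1 (x - y).
Proof.
rewrite -avgB.
rewrite (eq_bigr (fun y => avg M (fun w : seq step =>
    \sum_(j < M) (x - y + D (take j.+1 w) == 0)%:R))); last first.
  by move=> y _; rewrite avg_sum; apply: eq_bigr => j _; rewrite avg_take_heat.
rewrite -avg_sum; apply: le_avg => w _.
set rhs := leRHS.
have rhs0 : 0 <= rhs by do 2 (apply: sumr_ge0 => ? _); exact: ler0n.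
have [avA|_] := boolP (avoids M A x w); last first.
  by rewrite sub0r (le_trans _ rhs0)// oppr_le0 ler0n.
have [avAB|] := boolP (avoids M (A ++ B) x w); first by rewrite subrr.
rewrite subr0 -has_predC => /hasP[k kM /=]; rewrite negbK mem_cat.
rewrite (negbTE (allP avA _ kM))/= => kB.
move: kM; rewrite mem_iota => /andP[k1 kM].
have kM' : (k.-1 < M)%N by lia.
apply: le_trans (ler_sum_mem (f := fun y => \sum_(j < M) _) _ kB); last first.
  by move=> y; apply: sumr_ge0 => j _; exact: ler0n.
rewrite (bigD1 (Ordinal kM'))//= prednK// opprD addrA subrr sub0r addNr eqxx.
by rewrite lerDl sumr_ge0.
Qed.

(** A walk revisits sites; [undup] makes its list of positions stand for a set. *)
Definition tcap M A : R := \sum_(x <- undup A) escape M A x.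

Lemma tcap_translate M A z : tcap M [seq z + y | y <- A] = tcap M A.
Proof.
rewrite /tcap undup_map_inj; last exact: addrI.
by rewrite big_map; apply: eq_bigr => x _; exact: escape_translate.
Qed.

Lemma sum_undup_cat (f : V -> R) A B :
  \sum_(x <- undup (A ++ B)) f x =
  \sum_(x <- undup A) f x - \sum_(x <- undup A | x \in B) f x
  + \sum_(x <- undup B) f x.
Proof.
rewrite undup_cat big_cat/= big_filter; congr (_ + _).
by rewrite [in RHS](bigID (mem B))/= [X in _ = X - _]addrC addrK.
Qed.

Lemma tcap_cat_le M A B : tcap M (A ++ B) <= tcap M A + tcap M B.
Proof.
rewrite {1}/tcap sum_undup_cat lerD//; last first.
  by apply: ler_sum => x _; apply: escape_sub => y yB; rewrite mem_cat yB orbT.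
rewrite lerBlDr ler_wpDr//; first by apply: sumr_ge0 => x _; exact: escape_ge0.
by apply: ler_sum => x _; apply: escape_sub => y yB; rewrite mem_cat yB.
Qed.

Lemma green_head M x :
  green M x = (x == 0)%:R + \sum_(j < M) heat j.+1 x :> R.
Proof.
rewrite /green big_ord_recl; congr (_ + _).
by rewrite /heat/= /displacement big_nil addr0.
Qed.

Lemma greenN M x : green M (- x) = green M x :> R.
Proof. by apply: eq_bigr => j _; exact: heatN. Qed.

(** Each point of one set loses at most a Green sum over the other set, and common points are
    counted twice. The latter are absorbed by the time 0 terms of [green]. *)
Lemma tcap_cat_ge M A B :
  tcap M A + tcap M B - tcap M (A ++ B) <=
  2 * \sum_(x <- A) \sum_(y <- B) green M (x - y).
Proof.
pose h x : R := \sum_(j < M) heat j.+1 x.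
have h0 x : 0 <= h x by apply: sumr_ge0 => j _; exact: heat_ge0.
have hN x : h (- x) = h x by apply: eq_bigr => j _; exact: heatN.
have escBA x : escape M B x - escape M (A ++ B) x <= \sum_(y <- A) h (x - y).
  apply: le_trans (escape_diff_le M B A x); rewrite lerD2l lerN2.
  by apply: escape_sub => y; rewrite !mem_cat orbC.
apply: (@le_trans _ _ (\sum_(x <- A) \sum_(y <- B) h (x - y) +
   \sum_(y <- B) \sum_(x <- A) h (y - x) + \sum_(x <- A) (x \in B)%:R)).
  rewrite [tcap M (A ++ B)]/tcap sum_undup_cat.
  rewrite [leLHS](_ : _ =
      \sum_(x <- undup A) (escape M A x - escape M (A ++ B) x)
    + \sum_(x <- undup B) (escape M B x - escape M (A ++ B) x)
    + \sum_(x <- undup A | x \in B) escape M (A ++ B) x); last first.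
    by rewrite !sumrB /tcap; ring.
  apply: lerD; first apply: lerD.
  - apply: (@le_trans _ _ (\sum_(x <- undup A) \sum_(y <- B) h (x - y))).
      by apply: ler_sum => x _; exact: escape_diff_le.
    by apply: ler_sum_undup => x; apply: sumr_ge0.
  - apply: (@le_trans _ _ (\sum_(x <- undup B) \sum_(y <- A) h (x - y))).
      by apply: ler_sum => x _; exact: escBA.
    by apply: ler_sum_undup => x; apply: sumr_ge0.
  - apply: (@le_trans _ _ (\sum_(x <- undup A) (x \in B)%:R)).
      rewrite big_mkcond ler_sum// => x _.
      by case: (x \in B) => //; exact: escape_le1.
    by apply: (@ler_sum_undup _ _ A (fun x => (x \in B)%:R)) => x; exact: ler0n.
rewrite [X in _ + X + _]exchange_big/=.
rewrite -!big_split/= mulr_sumr; apply: ler_sum => x _.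
rewrite -big_split/= mulr_sumr.
apply: (@le_trans _ _ (\sum_(y <- B) (h (x - y) + h (y - x) + (x == y)%:R))).
  rewrite [leRHS]big_split/= lerD2l.
  have [xB|_] := boolP (x \in B); last by apply: sumr_ge0 => y _; exact: ler0n.
  apply: le_trans (ler_sum_mem (f := fun y => (x == y)%:R) _ xB) => //.
  by rewrite eqxx.
apply: ler_sum => y _; rewrite green_head subr_eq0 -[y - x]opprB hN.
by have : 0 <= (x == y)%:R :> R by []; rewrite /h; lra.
Qed.

Definition trace (w : seq step) : seq V :=
  [seq D (take k w) | k <- iota 0 (size w).+1].

(** Cutting at a step [s], not at a site, gives the two pieces disjoint ranges of times; hence the
    lengths [a.+1 + b] below. *)
Lemma trace_cat u s v :
  trace (u ++ s :: v) = trace u ++ [seq D (rcons u s) + y | y <- trace v].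
Proof.
rewrite /trace.
have -> : (size (u ++ s :: v)).+1 = ((size u).+1 + (size v).+1)%N by rewrite size_cat.
rewrite iotaD map_cat add0n; congr (_ ++ _).
  apply/eq_in_map => k; rewrite mem_iota ltnS => /andP[_ ku].
  by rewrite takel_cat.
rewrite -map_comp -[X in iota X _]addn0 iotaDl -map_comp.
apply: eq_map => k /=; rewrite -displacement_cat; congr D.
by rewrite -cat_rcons take_cat size_rcons ltnNge leq_addr/= addKn.
Qed.

(** The overlap chi. By translation invariance the second piece may be read from the origin, which
    makes it independent of the first. *)
Definition overlap M a (w : seq step) : R :=
  tcap M (trace (take a w)) + tcap M (trace (drop a.+1 w)) - tcap M (trace w).

Lemma overlap_ge0 M a w : (a < size w)%N -> 0 <= overlap M a w.
Proof.
case: w => [//|s0 w0]; set w := s0 :: w0 => aw.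
rewrite /overlap subr_ge0 -[in leLHS](cat_take_drop a w) (drop_nth s0 aw).
by rewrite trace_cat (le_trans (tcap_cat_le _ _ _))// tcap_translate.
Qed.

Lemma overlap_le M a b w : size w = (a.+1 + b)%N ->
  overlap M a w <=
  2 * \sum_(r < b.+1) \sum_(i < a.+1) green M (segment i (a.+1 + r) w).
Proof.
move=> sw; have [s0 _] : exists s0 : step, True.
  by case: w sw => [//|s0 w0 _]; exists s0.
have aw : (a < size w)%N by rewrite sw; lia.
have st : size (take a w) = a by rewrite size_takel// ltnW.
rewrite /overlap.
have -> : trace w = trace (take a w) ++
    [seq D (rcons (take a w) (nth s0 w a)) + y | y <- trace (drop a.+1 w)].
  by rewrite -trace_cat -drop_nth// cat_take_drop.
rewrite -[X in _ + X - _](tcap_translate _ _ (D (rcons (take a w) (nth s0 w a)))).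
apply: le_trans (tcap_cat_ge _ _ _) _; rewrite ler_pM2l// le_eqVlt.
apply/orP; left; apply/eqP; rewrite [RHS]exchange_big /trace big_map st sum_iota.
have rc : rcons (take a w) (nth s0 w a) = take a.+1 w by rewrite -take_nth.
apply: eq_bigr => i _; rewrite !big_map size_drop sw addKn sum_iota.
apply: eq_bigr => r _; rewrite take_takel; last by rewrite -ltnS.
by rewrite -greenN opprB -displacement_cat rc -takeD /segment.
Qed.

End truncated_capacity.

(** * Subgaussian upper tails *)

Section subgaussian.
Context {R : realType} {T : finType}.
Hypothesis T_gt0 : (0 < #|T|)%N.
Implicit Types (X Y : seq T -> R) (s t theta : R).

(* One-sided: only upper deviations are controlled. *)
Definition subgaussian n X s : Prop :=
  forall theta, 0 <= theta ->
    avg n (fun w => expR (theta * X w)) <= expR (s ^+ 2 * theta ^+ 2 / 2).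

Lemma subgaussian_le n X s t :
  0 <= s -> s <= t -> subgaussian n X s -> subgaussian n X t.
Proof.
move=> s0 st Xs theta th0; apply: le_trans (Xs _ th0) _.
rewrite ler_expR ler_pM2r// ler_wpM2r ?sqr_ge0// lerXn2r// nnegrE//.
exact: le_trans st.
Qed.

Lemma eq_subgaussian n X Y s : (forall w, size w = n -> X w = Y w) ->
  subgaussian n X s -> subgaussian n Y s.
Proof.
move=> XY Xs theta th0; rewrite -(eq_avg (g := fun w => expR (theta * X w))).
  exact: Xs.
by move=> w wn; rewrite XY.
Qed.

Lemma subgaussian0 n s : subgaussian n (fun=> 0) s.
Proof.
move=> theta th0; rewrite mulr0 avg_cst// ler_expR.
by rewrite divr_ge0// mulr_ge0 ?sqr_ge0.
Qed.

(** The exponential lies above its tangent at the barycentre [m]. *)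
Lemma expR_convex (p a b : R) : 0 <= p <= 1 ->
  expR (p * a + (1 - p) * b) <= p * expR a + (1 - p) * expR b.
Proof.
case/andP=> p0 p1; set m := p * a + _.
have tangent x : expR m * (1 + (x - m)) <= expR x.
  have -> : expR x = expR m * expR (x - m) by rewrite -expRD subrKC.
  by rewrite ler_pM2l ?expR_gt0// expR_ge1Dx.
have ha := ler_wpM2l p0 (tangent a).
have hb : (1 - p) * (expR m * (1 + (b - m))) <= (1 - p) * expR b.
  by rewrite ler_wpM2l// subr_ge0.
apply: le_trans (lerD ha hb); rewrite le_eqVlt; apply/orP; left; apply/eqP.
by rewrite /m; ring.
Qed.

(** [X] and [Y] may be dependent: convexity with weights proportional to [s] and [t] makes the
    standard deviation proxies add. *)
Lemma subgaussianD n X Y s t : 0 < s -> 0 < t ->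
  subgaussian n X s -> subgaussian n Y t ->
  subgaussian n (fun w => X w + Y w) (s + t).
Proof.
move=> s0 t0 Xs Yt theta th0.
have st0 : 0 < s + t by rewrite addr_gt0.
set p := s / (s + t).
have p01 : 0 <= p <= 1.
  by rewrite ler_pdivlMr// mul0r ler_pdivrMr// mul1r lerDl !ltW.
(* Chosen so that [p x = (1 - p) y = theta] and [s x = t y = (s + t) theta]: both exponentials get
   the same normalisation. *)
set x := (s + t) / s * theta; set y := (s + t) / t * theta.
have x0 : 0 <= x by rewrite mulr_ge0// divr_ge0// ltW.
have y0 : 0 <= y by rewrite mulr_ge0// divr_ge0// ltW.
set E := expR _; have E0 : 0 < E by rewrite expR_gt0.
rewrite -[leRHS]mulr1 -ler_pdivrMl// -avgZ.
have mgf Z u z : 0 <= z -> subgaussian n Z u ->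
    avg n (fun w => expR (z * Z w - u ^+ 2 * z ^+ 2 / 2)) <= 1.
  move=> z0 Zu; under eq_avg do rewrite expRD expRN.
  by rewrite avgZr ler_pdivrMr ?expR_gt0// mul1r Zu.
apply: (@le_trans _ _ (p * avg n (fun w => expR (x * X w - s ^+ 2 * x ^+ 2 / 2)) +
   (1 - p) * avg n (fun w => expR (y * Y w - t ^+ 2 * y ^+ 2 / 2)))).
  rewrite -!avgZ -avgD; apply: le_avg => w _.
  rewrite -expRN -expRD; apply: le_trans (expR_convex _ _ p01).
  rewrite ler_expR le_eqVlt; apply/orP; left; apply/eqP.
  by rewrite /p /x /y; field; lra.
have /andP[p0 p1] := p01.
have h1 := ler_wpM2l p0 (mgf X s x x0 Xs).
have h2 : (1 - p) * avg n (fun w => expR (y * Y w - t ^+ 2 * y ^+ 2 / 2)) <= (1 - p) * 1.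
  by apply: ler_wpM2l; [rewrite subr_ge0 | exact: mgf].
lra.
Qed.

Lemma subgaussian_indep a b X Y s t :
  subgaussian a X s -> subgaussian b Y t ->
  subgaussian (a.+1 + b) (fun w => X (take a w) + Y (drop a.+1 w))
    (Num.sqrt (s ^+ 2 + t ^+ 2)).
Proof.
move=> Xs Yt theta th0.
rewrite sqr_sqrtr ?addr_ge0 ?sqr_ge0// 2!mulrDl expRD.
rewrite addSnnS avg_cat.
have -> : avg a (fun u => avg b.+1 (fun v =>
      expR (theta * (X (take a (u ++ v)) + Y (drop a.+1 (u ++ v)))))) =
    avg a (fun u => expR (theta * X u)) * avg b (fun v => expR (theta * Y v)).
  rewrite -avgZr; apply: eq_avg => u su.
  (* The joining letter enters neither factor and averages out. *)
  rewrite avgS -avgZ -[RHS](avg_cst T_gt0 1) avgS; congr (_ * _).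
  apply: eq_bigr => s' _; apply: eq_avg => v _.
  rewrite take_size_cat// -cat_rcons drop_size_cat ?size_rcons ?su//.
  by rewrite mulrDr expRD.
apply: ler_pM; [| |exact: Xs|exact: Yt]; apply: avg_ge0 => w _; exact: expR_ge0.
Qed.

(** From [expR (- x) <= 1 / (1 + x)] and $(1+x)(1-x+x^2) = 1+x^3$. *)
Lemma expRN_le (x : R) : 0 <= x -> expR (- x) <= 1 - x + x ^+ 2.
Proof.
move=> x0; have x1 : 0 < 1 + x by lra.
apply: (@le_trans _ _ (1 + x)^-1).
  by rewrite expRN lef_pV2 ?posrE ?expR_gt0// expR_ge1Dx.
rewrite -[leLHS]mul1r ler_pdivrMr//.
by have := exprn_ge0 3 x0; nra.
Qed.

(** Nonnegativity of [X] gives access to [expRN_le]; the first-order terms cancel and only the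
    second moment remains. The factor 2 rounds up [sqrt 2]. *)
Lemma subgaussian_mean_sub n X v : 0 <= v ->
  (forall w, size w = n -> 0 <= X w) ->
  avg n (fun w => X w ^+ 2) <= v ^+ 2 ->
  subgaussian n (fun w => avg n X - X w) (2 * v).
Proof.
move=> v0 X0 Xv theta th0; set mu := avg n X.
apply: (@le_trans _ _ (expR (theta * mu) * (1 - theta * mu + theta ^+ 2 * v ^+ 2))).
  under eq_avg do rewrite mulrBr expRD.
  rewrite avgZ ler_pM2l ?expR_gt0//.
  apply: (@le_trans _ _ (avg n (fun w => 1 - theta * X w + theta ^+ 2 * X w ^+ 2))).
    apply: le_avg => w wn; rewrite -exprMn; apply: expRN_le.
    by rewrite mulr_ge0// X0.
  rewrite avgD avgB avg_cst// !avgZ lerD2l ler_wpM2l ?sqr_ge0//.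
apply: (@le_trans _ _ (expR (theta * mu) * expR (- (theta * mu) + theta ^+ 2 * v ^+ 2))).
  by rewrite ler_pM2l ?expR_gt0// -addrA expR_ge1Dx.
rewrite -expRD addrA subrr add0r ler_expR.
by have := mulr_ge0 (sqr_ge0 theta) (sqr_ge0 v); lra.
Qed.

End subgaussian.

(** * Recursion on the number of steps *)

Section capacity_subgaussian.
Context {R : realType} {d : nat} (K alpha : R).
Hypothesis d_gt0 : (0 < d)%N.
Hypothesis alpha_ge : 5 / 2 <= alpha.
Hypothesis alpha_lt : alpha < 3.
Hypothesis heatK : forall n (x : Zlattice d), heat n x <= K * npow n (- alpha).
Local Notation step := ('I_d * bool)%type.

Local Notation overlap := (@overlap R d).
Local Notation green := (@green R d).
Local Notation tcap := (@tcap R d).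

Definition centered_tcap M n (w : seq step) : R :=
  tcap M (trace w) - avg n (fun v : seq step => tcap M (trace v)).

Let card_gt0 : (0 < #|{: step}|)%N.
Proof. by rewrite card_step muln_gt0. Qed.

Lemma avg_take a b (f : seq step -> R) :
  avg (a + b) (fun w => f (take a w)) = avg a f.
Proof.
rewrite avg_cat; apply: eq_avg => u su.
by rewrite -[RHS](avg_cst card_gt0 b); apply: eq_avg => v _; rewrite take_size_cat.
Qed.

Lemma avg_drop a b (f : seq step -> R) :
  avg (a + b) (fun w => f (drop a w)) = avg b f.
Proof.
rewrite avg_cat -[RHS](avg_cst card_gt0 a); apply: eq_avg => u su.
by apply: eq_avg => v _; rewrite drop_size_cat.
Qed.

Lemma centered_tcap_split M a b w :
  centered_tcap M (a.+1 + b) w =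
  centered_tcap M a (take a w) + centered_tcap M b (drop a.+1 w) +
  (avg (a.+1 + b) (overlap M a) - overlap M a w).
Proof.
have h1 := avg_take a b.+1 (fun v : seq step => tcap M (trace v)).
rewrite -addSnnS in h1.
have h2 := avg_drop a.+1 b (fun v : seq step => tcap M (trace v)).
rewrite /overlap avgB avgD h1 h2 /centered_tcap; ring.
Qed.

Local Notation mc := (@moment_cst R K alpha).

Lemma overlap_subgaussian M a b :
  subgaussian (a.+1 + b)
    (fun w => avg (a.+1 + b) (overlap M a) - overlap M a w)
    (4 * mc * npow b (3 - alpha)).
Proof.
have mc0 := moment_cst_gt0 alpha_ge alpha_lt heatK.
(* One factor 2 comes from [subgaussian_mean_sub], the other from [overlap_le]. *)
have -> : 4 * mc * npow b (3 - alpha) = 2 * (2 * (mc * npow b (3 - alpha))) by ring.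
apply: subgaussian_mean_sub => //.
- by rewrite mulr_ge0// mulr_ge0 ?npow_ge0 ?(ltW mc0).
- by move=> w sw; apply: overlap_ge0 => //; rewrite sw; lia.
apply: (@le_trans _ _ (4 * avg (a.+1 + b) (fun w : seq step => (\sum_(r < b.+1)
    \sum_(i < a.+1) green M (segment i (a.+1 + r) w)) ^+ 2))); last first.
  rewrite exprMn (_ : 2 ^+ 2 = 4); last by ring.
  by rewrite ler_pM2l//; apply: avg_green_sqr_le.
rewrite -avgZ; apply: le_avg => w sw.
rewrite (_ : 4 = 2 ^+ 2); last by ring.
rewrite -exprMn lerXn2r ?nnegrE//.
- by apply: overlap_ge0 => //; rewrite sw; lia.
- by rewrite mulr_ge0// !sumr_ge0// => r _; apply: sumr_ge0 => i _; exact: green_ge0.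
- exact: overlap_le.
Qed.

(** [f] is the proxy divided by [sqrt (n + 1)]. The independent halves combine in quadrature and,
    their numbers of points adding up to [n + 1], do not raise [f]; the overlap, of order
    [n ^ (3 - alpha)], adds order [n ^ (5/2 - alpha)]. *)
Lemma centered_tcap_subgaussian (f : nat -> R) : (forall n, 0 < f n) ->
  (forall n m, (0 < n)%N -> (m <= n./2)%N ->
     f m + 4 * mc * npow n (5 / 2 - alpha) <= f n) ->
  forall M n, subgaussian n (centered_tcap M n) (Num.sqrt n.+1%:R * f n).
Proof.
move=> f0 fS M n.
have mc0 := moment_cst_gt0 alpha_ge alpha_lt heatK.
have ha := alpha_ge; have hb := alpha_lt.
elim/ltn_ind: n => n ih.
have [->|n0] := posnP n.
  apply: eq_subgaussian (@subgaussian0 R _ card_gt0 0 _) => -[|//] _.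
  by rewrite /centered_tcap/= subrr.
(* One step joins the halves, so [a + 1 + b = n], and both lengths are at most [n./2] as [fS]
   requires. *)
pose b := n./2; pose a := (n - b.+1)%N.
have ab : n = (a.+1 + b)%N by rewrite /a /b; lia.
have [an bn] : (a < n)%N /\ (b < n)%N by rewrite /a /b; lia.
have fa := fS n a n0 ltac:(rewrite /a /b; lia).
have fb := fS n b n0 (leqnn _).
set D := 4 * mc * npow n (5 / 2 - alpha) in fa fb.
have mc4 : 0 < 4 * mc by rewrite mulr_gt0.
have D0 : 0 < D by rewrite mulr_gt0 ?npow_gt0.
(* The share of [f n] left to the halves once the overlap has taken [D]. *)
set F := f n - D.
have fF m : f m + D <= f n -> f m ^+ 2 <= F ^+ 2.
  by move=> h; have fm := f0 m; rewrite lerXn2r ?nnegrE /F; lra.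
have F0 : 0 < F by rewrite /F; have := f0 a; lra.
have split_le : subgaussian n (fun w => centered_tcap M a (take a w) +
    centered_tcap M b (drop a.+1 w)) (Num.sqrt n.+1%:R * F).
  rewrite {1}ab; apply: subgaussian_le (subgaussian_indep card_gt0 (ih a an) (ih b bn)).
    exact: sqrtr_ge0.
  rewrite -[X in _ <= _ * X](ger0_norm (ltW F0)) -sqrtr_sqr -sqrtrM//.
  rewrite ler_wsqrtr// !exprMn !sqr_sqrtr//.
  have -> : n.+1%:R = a.+1%:R + b.+1%:R :> R by rewrite -natrD; congr _%:R; lia.
  by rewrite mulrDl lerD// ler_wpM2l// fF.
apply: (@eq_subgaussian _ _ _ (fun w => centered_tcap M a (take a w) +
   centered_tcap M b (drop a.+1 w) +
   (avg (a.+1 + b) (overlap M a) - overlap M a w))).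
  by move=> w _; rewrite -centered_tcap_split -ab.
have ov : subgaussian n (fun w => avg (a.+1 + b) (overlap M a) - overlap M a w)
    (Num.sqrt n.+1%:R * D).
  rewrite {1}ab; apply: subgaussian_le (overlap_subgaussian M a b).
    by rewrite mulr_ge0 ?npow_ge0// ltW.
  have -> : Num.sqrt n.+1%:R = npow n 2^-1 :> R by rewrite /npow powR12_sqrt.
  rewrite /D [leRHS]mulrCA -npowD.
  rewrite ler_pM2l//.
  rewrite (_ : 2^-1 + _ = 3 - alpha); last by lra.
  by apply: npow_ge; [lra | exact: ltnW].
have -> : Num.sqrt n.+1%:R * f n = Num.sqrt n.+1%:R * F + Num.sqrt n.+1%:R * D.
  by rewrite /F; ring.
by apply: subgaussianD => //; rewrite mulr_gt0// sqrtr_gt0 ltr0n.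
Qed.

End capacity_subgaussian.

(** * Solutions of the recursion for the normalised proxy *)

Section growth.
Context {R : realType}.

Lemma half_ratio n m : (0 < n)%N -> (m <= n./2)%N ->
  (4 / 3 : R) <= n.+1%:R / m.+1%:R.
Proof.
move=> n0 mn; rewrite ler_pdivlMr ?ltr0n// mulrAC ler_pdivrMr//.
by rewrite -!natrM ler_nat; lia.
Qed.

(** Case [alpha = 5 / 2]: each halving costs the same [c], while the logarithm drops by at least
    [ln (4 / 3)]. *)
Lemma log_growth (c : R) : 0 < c -> exists2 C : R, 0 < C &
  let f n := C * (1 + ln n.+1%:R) in
  (forall n, 0 < f n) /\
  forall n m, (0 < n)%N -> (m <= n./2)%N -> f m + c <= f n.
Proof.
move=> c0; have l0 : 0 < ln (4 / 3 : R) by rewrite ln_gt0//; lra.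
exists (c / ln (4 / 3)) => [|f]; first by rewrite divr_gt0.
split=> [n|n m n0 mn].
  by rewrite mulr_gt0 ?divr_gt0// ltr_wpDr// ln_ge0// ler1n.
rewrite /f -lerBrDl -mulrBr opprD addrACA subrr add0r -ln_div ?posrE ?ltr0n//.
rewrite mulrAC -[leLHS]mulr1 -mulrA ler_pM2l// ler_pdivlMr// mul1r.
by rewrite ler_ln ?posrE ?divr_gt0 ?ltr0n// half_ratio.
Qed.

(** Case [alpha = 11 / 4]: the costs decay geometrically along the halvings, so [f] stays below
    [2 C]. The gain per halving is [q - 1] times the current [npow n (- 4^-1)]. *)
Lemma bounded_growth (c : R) : 0 < c -> exists2 C : R, 0 < C &
  let f n := C * (2 - npow n (- 4^-1)) in
  (forall n, 0 < f n) /\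
  forall n m, (0 < n)%N -> (m <= n./2)%N -> f m + c * npow n (- 4^-1) <= f n.
Proof.
move=> c0; set q := (4 / 3 : R) `^ 4^-1.
have q1 : 0 < q - 1.
  rewrite subr_gt0 /q -[ltLHS](_ : 1 `^ 4^-1 = 1); last by rewrite powR1.
  by rewrite gt0_ltr_powR ?nnegrE//; lra.
exists (c / (q - 1)) => [|f]; first by rewrite divr_gt0.
split=> [n|n m n0 mn].
  rewrite mulr_gt0 ?divr_gt0// subr_gt0.
  apply: (@le_lt_trans _ _ (npow n 0)); first by apply: npow_le_expo; lra.
  by rewrite /npow powRr0; lra.
have h : q * npow n (- 4^-1) <= npow m (- 4^-1).
  rewrite /npow !powRN ler_pdivrMr ?powR_gt0 ?ltr0n//.
  rewrite -(@divfK _ m.+1%:R _ n.+1%:R) ?pnatr_eq0// powRM ?divr_ge0//.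
  rewrite mulrCA mulVf ?mulr1 ?gt_eqF ?powR_gt0 ?ltr0n//.
  by rewrite ge0_ler_powR ?nnegrE ?divr_ge0 ?half_ratio//; lra.
have g : c * npow n (- 4^-1) = c / (q - 1) * ((q - 1) * npow n (- 4^-1)).
  by field; lra.
by rewrite /f g -mulrDr ler_pM2l ?divr_gt0//; lra.
Qed.

End growth.

(** * From words to the random walk *)

Lemma avg_tuple {R : realType} {T : finType} n (g : seq T -> R) :
  avg n g = #|T|%:R ^- n * \sum_(t : n.-tuple T) g t.
Proof.
elim: n g => [|n ih] g.
  rewrite /= expr0 invr1 mul1r (bigD1 [tuple])//= big1 ?addr0// => t.
  by rewrite [t]tuple0 => /eqP.
rewrite avgS exprS invfM -mulrA; congr (_ * _).
under eq_bigr do rewrite ih.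
rewrite -mulr_sumr; congr (_ * _); rewrite pair_big/=.
pose h (p : T * n.-tuple T) := [tuple of p.1 :: p.2].
rewrite [RHS](reindex h)/=; first by apply: eq_bigr => -[].
exists (fun t => (thead t, [tuple of behead t])) => [[s t]|t] _.
  by congr (_, _); apply: val_inj.
by rewrite /h/= -tuple_eta.
Qed.

Lemma step_vec_inj d : injective (@step_vec d).
Proof.
move=> [i b] [j c] e; have := congr1 (fun v : Zlattice d => v 0 i) e.
rewrite /step_vec/= !mxE !eqxx/= mulr1.
have [->|ij] := eqVneq i j; last first.
  by rewrite ?andbF mulr0 => /eqP; rewrite signr_eq0.
by rewrite mulr1; case: b c {e} => -[].
Qed.

Lemma displacement_rcons d (u : seq ('I_d * bool)) s :
  displacement (rcons u s) = displacement u + step_vec s.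
Proof. by rewrite -cats1 displacement_cat /displacement big_seq1. Qed.

(** Increments recover the letters; hence path events of distinct words are disjoint. *)
Lemma trace_inj d (u v : seq ('I_d * bool)) : size u = size v ->
  trace u = trace v -> u = v.
Proof.
move=> uv tuv; have [/size0nil u0|] := posnP (size u).
  by rewrite u0 in uv *; case: v uv {tuv}.
move=> u0; have [s0 _] : exists s0 : 'I_d * bool, True.
  by case: u u0 {uv tuv} => // s0; exists s0.
have e k : (k <= size u)%N -> displacement (take k u) = displacement (take k v).
  move=> ku; have := congr1 (fun s => nth 0 s k) tuv.
  rewrite (nth_map 0%N) ?size_iota// (nth_map 0%N) ?size_iota -?uv//.
  by rewrite !nth_iota ?ltnS -?uv.
apply: (@eq_from_nth _ s0) => // k ku; apply: step_vec_inj.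
have := e k.+1 ku; rewrite (take_nth s0 ku) (take_nth s0) -?uv//.
by rewrite !displacement_rcons (e k (ltnW ku)) => /addrI.
Qed.

Section walk_law.
Context {R : realType} {d : nat} {disp : measure_display}.
Context {T : measurableType disp}.
Context (P : probability T R) (S : nat -> T -> Zlattice d) (x : Zlattice d).
Hypothesis d_gt0 : (0 < d)%N.
Hypothesis hS : simple_random_walk P S x.
Local Notation step := ('I_d * bool)%type.
Local Notation V := (Zlattice d).

Definition walk_path n w : seq V := [seq S k w | k <- iota 0 n.+1].

Lemma nth_walk_path n w k : (k <= n)%N -> nth 0 (walk_path n w) k = S k w.
Proof. by move=> kn; rewrite (nth_map 0%N) ?size_iota// nth_iota. Qed.

(** There are only countably many lists over the lattice, so an arbitrary [B] is a countable union
    of single paths. *)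
Lemma measurable_walk_path n (B : set (seq V)) :
  measurable [set w | B (walk_path n w)].
Proof.
have one (ks : seq nat) s : measurable [set w | [seq S k w | k <- ks] = s].
  elim: ks s => [|k ks ih] [|y s].
  - by rewrite (_ : [set _ | _] = setT)//; apply/seteqP; split.
  - by rewrite (_ : [set _ | _] = set0)//; apply/seteqP; split.
  - by rewrite (_ : [set _ | _] = set0)//; apply/seteqP; split.
  - rewrite (_ : [set _ | _] =
        (S k @^-1` [set y]) `&` [set w | [seq S k w | k <- ks] = s]).
      by apply: measurableI; [exact: (srw_measurable hS) | exact: ih].
    apply/seteqP; split=> w /=; last by move=> [-> ->].
    by move=> h; have := congr1 behead h; have := congr1 (head 0) h.
rewrite (_ : [set _ | _] = \bigcup_(s : seq V) [set w | B s /\ walk_path n w = s]).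
  apply: countable_bigcupT_measurable; first exact: countableP.
  move=> s; have [Bs|nBs] := pselect (B s).
    rewrite (_ : [set _ | _] = [set w | walk_path n w = s]); first exact: one.
    by apply/seteqP; split=> w /= => [[]|].
  by rewrite (_ : [set _ | _] = set0)//; apply/seteqP; split=> w /= => [[]|].
apply/seteqP; split=> w /=; first by move=> Bw; exists (walk_path n w).
by case=> s _ [Bs ->].
Qed.

Definition path_event (u : seq step) : set T :=
  [set w | walk_path (size u) w = [seq x + y | y <- trace u]].

Lemma measurable_path_event u : measurable (path_event u).
Proof.
exact: (measurable_walk_path (size u) [set s | s = [seq x + y | y <- trace u]]).
Qed.

Lemma path_eventP u w :
  path_event u w <-> forall k, (k <= size u)%N -> S k w = x + displacement (take k u).
Proof.
rewrite /path_event/= /walk_path /trace -map_comp; split.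
  move=> /eq_in_map h k ku; apply: h.
  by rewrite mem_iota add0n ltnS.
by move=> h; apply/eq_in_map => k; rewrite mem_iota add0n ltnS => /h.
Qed.

(** Discards the starting point, which is prescribed only almost surely. *)
Lemma probability_setI1 (A B : set T) : measurable A -> measurable B ->
  P A = 1%E -> P (A `&` B) = P B.
Proof.
move=> mA mB PA.
have BA : P (B `\` A) = 0%E.
  apply/eqP; rewrite eq_le measure_ge0 andbT.
  have -> : 0%E = P (~` A) by rewrite probability_setC// PA subee.
  apply: le_measure => [||w []//]; rewrite inE; first exact: measurableD.
  exact: measurableC.
by rewrite setIC -[LHS]adde0 -BA addeC -measureDI.
Qed.

Lemma probability_path_event u : P (path_event u) = ((2 * d)%:R^-1 ^+ size u)%:E.
Proof.
have s0 : step := (Ordinal d_gt0, true).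
set n := size u.
pose J : {fset nat} := [fset k in iota 0 n]%fset.
pose B k : set V := [set step_vec (nth s0 u k)].
have mS k (C : set V) : measurable (S k @^-1` C) by exact: (srw_measurable hS).
pose E := \bigcap_(k in [set` J]) ((fun w => S k.+1 w - S k w) @^-1` B k).
have EJ : path_event u = [set w | S 0%N w = x] `&` E.
  apply/seteqP; split=> w.
    move=> /path_eventP uw; split=> /=.
      by rewrite uw// take0 /displacement big_nil addr0.
    move=> k /=; rewrite !inE mem_iota add0n => /andP[_ kn].
    rewrite /B/= !uw ?(ltnW kn)// (take_nth s0 kn) displacement_rcons.
    by apply: (canLR (addrK _)); rewrite addrA addrC.
  move=> [/= w0 Ew]; apply/path_eventP; elim=> [_|k ih kn].
    by rewrite w0 take0 /displacement big_nil addr0.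
  have := Ew k; rewrite /B/= !inE mem_iota add0n => /(_ kn)/eqP.
  rewrite subr_eq => /eqP ->; rewrite (take_nth s0 kn) displacement_rcons.
  by rewrite ih ?(ltnW kn)// addrC addrA.
rewrite EJ probability_setI1.
- rewrite /E (srw_indep hS J B).
  rewrite (eq_bigr (fun=> ((2 * d)%:R^-1)%:E)); last first.
    move=> k _; apply: (srw_step hS); case: (nth s0 u k) => i b.
    by exists i, b.
  rewrite prodEFin; congr (_%:E).
  have -> : n = size J by rewrite card_fseq undup_id ?iota_uniq ?size_iota.
  by elim: (enum_fset J) => [|k s ih]; rewrite ?big_nil// big_cons ih exprS.
- exact: (mS 0%N [set x]).
- apply: fin_bigcap_measurable.
  exact: finite_fset.
  move=> k _.
  rewrite (_ : _ @^-1` _ = [set w | [set s : seq V | nth 0 s k.+1 - nth 0 s k =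
      step_vec (nth s0 u k)] (walk_path k.+1 w)]); first exact: measurable_walk_path.
  by apply/funext => w; rewrite /preimage /mkset !nth_walk_path.
- exact: (srw_start hS).
Qed.

(** The path events of words of length [n] are disjoint, equally likely and of full mass, so the
    integral is a finite average. *)
Lemma integral_walk n (phi : seq V -> R) : (forall s, 0 <= phi s) ->
  (\int[P]_w (phi (walk_path n w))%:E =
   (avg n (fun u => phi [seq x + y | y <- trace u]))%:E)%E.
Proof.
move=> phi0.
pose D := \big[setU/set0]_(t <- enum {: n.-tuple step}) path_event t.
have mphi (f : seq V -> R) (A : set T) : measurable A ->
    measurable_fun A (fun w => (f (walk_path n w))%:E).
  move=> mA; apply/measurable_EFinP => _ Y mY; apply: measurableI => //.
  exact: (measurable_walk_path n (f @^-1` Y)).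
have mD : measurable D.
  by apply: bigsetU_measurable => t _; exact: measurable_path_event.
have intD (f : seq V -> R) : (forall s, 0 <= f s) ->
    (\int[P]_(w in D) (f (walk_path n w))%:E =
     (avg n (fun u => f [seq x + y | y <- trace u]))%:E)%E.
  move=> f0; rewrite ge0_integral_bigsetU//=.
  - rewrite avg_tuple big_enum/= mulr_sumr -sumEFin; apply: eq_bigr => t _.
    under eq_integral.
      move=> w; rewrite inE => tw.
      have -> : walk_path n w = [seq x + y | y <- trace t].
        by rewrite -[X in walk_path X w](size_tuple t).
      over.
    rewrite integral_cst//=; last exact: measurable_path_event.
    by rewrite probability_path_event size_tuple card_step exprVn -EFinM mulrC.
  - by move=> t; exact: measurable_path_event.
  - exact: enum_uniq.
  - move=> t t' _ _ [w [tw t'w]]; apply: val_inj; apply: trace_inj.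
      by rewrite !size_tuple.
    by move: tw t'w; rewrite /path_event /mkset !size_tuple => -> /(inj_map (addrI x)).
  - exact: mphi.
  - by move=> w _; rewrite lee_fin.
(* Full mass is the case [phi = 1] of the computation on [D]. *)
have PD : P D = 1%E.
  have := intD (fun=> 1) (fun=> ler01).
  rewrite integral_cst// mul1e => ->.
  by rewrite avg_cst// card_step muln_gt0.
have PC : P (~` D) = 0%E by rewrite probability_setC// PD subee.
rewrite (@ge0_negligible_integral _ _ _ _ setT (~` D))//.
- by rewrite setTD setCK intD.
- exact: measurableC.
- exact: mphi.
- by move=> w _; rewrite lee_fin.
Qed.

End walk_law.

Section walk_probability.
Context {R : realType} {d : nat} {disp : measure_display}.
Context {T : measurableType disp}.
Context (P : probability T R) (S : nat -> T -> Zlattice d) (x : Zlattice d).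
Hypothesis d_gt0 : (0 < d)%N.
Hypothesis hS : simple_random_walk P S x.
Local Notation V := (Zlattice d).

Lemma probability_walk n (b : pred (seq V)) :
  P [set w | b (walk_path S n w)] =
  (avg n (fun u => (b [seq x + y | y <- trace u])%:R))%:E.
Proof.
set E := [set w | _].
have mE : measurable E by exact: (measurable_walk_path hS n [set s | b s]).
rewrite -(integral_walk d_gt0 hS n (fun s => ler0n _ (b s))).
rewrite -[X in P X]setIT -(integral_indic P measurableT mE).
apply: eq_integral => w _; rewrite indicE; congr ((nat_of_bool _)%:R%:E).
by apply/idP/idP => [|h]; rewrite ?inE.
Qed.

Lemma return_time_infty (A : seq V) w :
  return_time R S [set` A] w = +oo%E <->
  forall k, (1 <= k)%N -> S k w \notin A.
Proof.
rewrite /return_time; split=> [/ereal_inf_pinfty h k k1|h].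
  by apply/negP => kA; have /h : [set n%:R%:E | n in [set n | (1 <= n)%N /\
    [set` A] (S n w)]] (k%:R%:E : \bar R) by exists k.
apply/ereal_inf_pinfty => t [k [k1 kA] _].
by have := h k k1; rewrite kA.
Qed.

(** Continuity from above along the decreasing events of no return up to time [M]. *)
Lemma cvg_escape (A : seq V) :
  escape M A x @[M --> \oo] -->
  fine (P [set w | return_time R S [set` A] w = +oo%E]).
Proof.
pose F M := [set w | all (fun k => S k w \notin A) (iota 1 M)].
have FE M : F M = [set w | all (fun k => nth 0 (walk_path S M w) k \notin A) (iota 1 M)].
  apply/funext => w; rewrite /F /mkset; congr is_true; apply: eq_in_all => k.
  by rewrite mem_iota => /andP[_ kM]; rewrite nth_walk_path//; lia.
have PF M : P (F M) = (escape M A x)%:E.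
  rewrite FE (probability_walk M (fun s => all (fun k => nth 0 s k \notin A) (iota 1 M))).
  congr (_%:E); apply: eq_avg => w wM; congr (nat_of_bool _)%:R.
  apply: eq_in_all => k; rewrite mem_iota => /andP[_ kM].
  rewrite (nth_map 0) ?size_map ?size_iota ?wM; last lia.
  by rewrite (nth_map 0%N) ?size_iota ?wM ?nth_iota ?wM//; lia.
have mF M : measurable (F M).
  rewrite FE; exact: (measurable_walk_path hS M
    [set s | all (fun k => nth 0 s k \notin A) (iota 1 M)]).
have capF : \bigcap_M F M = [set w | return_time R S [set` A] w = +oo%E].
  apply/seteqP; split=> w /=.
    move=> Fw; apply/return_time_infty => k k1.
    by apply: (allP (Fw k I)); rewrite mem_iota; lia.
  move=> /return_time_infty h M _; apply/allP => k; rewrite mem_iota => /andP[k1 _].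
  exact: h.
rewrite -capF.
have mI : measurable (\bigcap_M F M) by exact: bigcap_measurable.
have niF : nonincreasing_seq F.
  apply/nonincreasing_seqP => M; apply/subsetPset => w /allP Fw; apply/allP => k.
  by rewrite mem_iota => kM; apply: Fw; rewrite mem_iota; lia.
have F0 : (P (F 0%N) < +oo)%E by rewrite PF ltry.
have := nonincreasing_cvg_mu F0 mF mI niF.
rewrite -[X in _ --> X -> _]fineK; last exact: fin_num_measure.
move=> /fine_cvg; apply: cvg_trans; apply: near_eq_cvg.
by near=> M; rewrite /= PF.
Unshelve. all: by end_near.
Qed.

End walk_probability.

(** * Removal of the truncation and deviation bound *)

Section capacity_limit.
Context {R : realType} {d : nat} {disp : measure_display}.
Context {T : measurableType disp}.
Context (P : Zlattice d -> probability T R) (S : nat -> T -> Zlattice d).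
Hypothesis d_gt0 : (0 < d)%N.
Hypothesis hS : forall x, simple_random_walk (P x) S x.
Local Notation V := (Zlattice d).

Lemma capacity_seq (A : seq V) : capacity P S [set` A] =
  \sum_(x <- undup A) fine (P x [set w | return_time R S [set` A] w = +oo%E]).
Proof.
rewrite /capacity [RHS]fsbig_seq ?undup_uniq//.
rewrite (_ : [set` undup A] = [set` A])//.
by apply/seteqP; split=> x /=; rewrite mem_undup.
Qed.

Lemma capacity_seq_ge0 (A : seq V) : 0 <= capacity P S [set` A].
Proof. by rewrite capacity_seq; apply: sumr_ge0 => x _; exact: fine_ge0. Qed.

Lemma cvg_tcap (A : seq V) : tcap M A @[M --> \oo] --> capacity P S [set` A].
Proof.
rewrite capacity_seq; apply: cvg_big => [|x _].
  by move=> x; exact: add_continuous.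
exact: cvg_escape.
Qed.

Lemma walk_rangeE n w : walk_range S n w = [set` walk_path S n w].
Proof.
apply/seteqP; split=> y /=.
  move=> [k kn <-]; apply/mapP; exists k => //.
  by rewrite mem_iota add0n ltnS.
by case/mapP => k; rewrite mem_iota add0n ltnS => kn ->; exists k.
Qed.

Local Notation cap := (fun u : seq ('I_d * bool) => capacity P S [set` trace u]).

(** For fixed [n] the averages are finite sums, and [s] is the same for all [M], so the bound passes
    to the limit. *)
Lemma capacity_subgaussian n s :
  (forall M, subgaussian n (@centered_tcap R d M n) s) ->
  subgaussian n (fun u => cap u - avg n cap) s.
Proof.
move=> Ms theta th0.
have lim : avg n (fun u => expR (theta * @centered_tcap R d M n u)) @[M --> \oo] -->
    avg n (fun u => expR (theta * (cap u - avg n cap))).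
  apply: cvg_avg => u un.
  apply: (@continuous_cvg _ _ _ _ _ _ expR); first exact: continuous_expR.
  apply: cvgMl_tmp; apply: cvgB; first exact: cvg_tcap.
  by apply: (cvg_avg (g := fun M v => tcap M (trace v))) => v _; exact: cvg_tcap.
apply: (cvgr_to_le lim); near=> M; exact: Ms.
Unshelve. all: by end_near.
Qed.

Lemma capacity_deviation n s zeta : 0 < s -> 0 < zeta ->
  (forall M, subgaussian n (@centered_tcap R d M n) s) ->
  forall Cap_n : T -> R, (forall w, Cap_n w = capacity P S (walk_range S n w)) ->
  (P 0%R [set w | zeta%:E <= (Cap_n w)%:E - 'E_(P 0%R)[Cap_n]] <=
   (expR (- (zeta ^+ 2 / (2 * s ^+ 2))))%:E)%E.
Proof.
move=> s0 zeta0 Ms Cap_n CapE; have Xs := capacity_subgaussian Ms.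
have tr0 (u : seq ('I_d * bool)) : [seq (0 : V) + y | y <- trace u] = trace u.
  by rewrite (eq_map (@add0r V)) map_id.
have -> : ('E_(P 0%R)[Cap_n] = (avg n cap)%:E)%E.
  rewrite unlock; under eq_integral do rewrite CapE walk_rangeE.
  rewrite (integral_walk d_gt0 (hS 0) n capacity_seq_ge0).
  by congr (_%:E); apply: eq_avg => u _; rewrite tr0.
rewrite (_ : [set w | _] = [set w | zeta <=
    capacity P S [set` walk_path S n w] - avg n cap]); last first.
  by apply/funext => w; rewrite /mkset CapE walk_rangeE -EFinB lee_fin.
rewrite (probability_walk d_gt0 (hS 0) n
  (fun A => zeta <= capacity P S [set` A] - avg n cap)) lee_fin.
(* The minimiser of the Chernoff exponent [s ^ 2 theta ^ 2 / 2 - theta zeta]. *)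
set theta := zeta / s ^+ 2.
have th0 : 0 < theta by rewrite divr_gt0// exprn_gt0.
apply: (@le_trans _ _ (avg n (fun u =>
    expR (theta * (cap u - avg n cap)) * expR (- (theta * zeta))))).
  apply: le_avg => u _; rewrite tr0 -expRD -mulrBr.
  have [h|_] := boolP (zeta <= _); last exact: expR_ge0.
  by rewrite -expR0 ler_expR mulr_ge0 ?subr_ge0// ltW.
rewrite avgZr; apply: le_trans (ler_wpM2r (expR_ge0 _) (Xs _ (ltW th0))) _.
rewrite -expRD ler_expR le_eqVlt; apply/orP; left; apply/eqP.
by rewrite /theta; field; lra.
Qed.

End capacity_limit.

(** * Conclusion *)

Definition variance_scale {R : realType} (d n : nat) : R :=
  if d == 5%N then n%:R * ln n%:R ^+ 3
  else if d == 6%N then n%:R * ln (ln n%:R) ^+ 2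
  else n%:R.

(** * Comparison with the scales of the theorem *)

Section scales.
Context {R : realType}.

Lemma ln2_bounds : 0 < ln (2 : R) < 1.
Proof.
rewrite ln_gt0 ?ltr1n//= -ltr_expR lnK ?posrE//.
by have := @expR_gt1Dx R 1 (oner_neq0 _); rewrite -natr1.
Qed.

(** From [expR (- 1 / 6) >= 5 / 6] and [(5 / 6) ^ 6 > 1 / 3]. *)
Lemma ln3_gt1 : 1 < ln (3 : R).
Proof.
rewrite -ltr_expR lnK ?posrE//.
have h : (5 / 6 : R) <= expR (- 6^-1).
  by apply: le_trans (expR_ge1Dx _); lra.
have e : expR 1 * expR (- 6^-1) ^+ 6 = 1 :> R.
  by rewrite -expRM_natl -expRD -[RHS]expR0; congr expR; lra.
have h6 : (5 / 6 : R) ^+ 6 <= expR (- 6^-1) ^+ 6.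
  by rewrite lerXn2r// nnegrE ?expR_ge0//; lra.
have q : 1 < 3 * (5 / 6 : R) ^+ 6 by rewrite !exprS expr0; lra.
have p6 : 0 < expR (- 6^-1 : R) ^+ 6 by rewrite exprn_gt0// expR_gt0.
by rewrite -(ltr_pM2r p6) e (lt_le_trans q)// ler_pM2l.
Qed.

(** At [n = 2] the iterated logarithm is negative but nonzero; from 3 on it is positive and
    increasing. So a proxy of order [sqrt n] fits the scale for [d = 6]. *)
Lemma lnln_sqr_ge : exists2 e : R, 0 < e &
  forall n, (2 <= n)%N -> e <= ln (ln n%:R) ^+ 2.
Proof.
have /andP[l2 l2'] := ln2_bounds; have l3 := ln3_gt1.
have a0 : 0 < ln (ln 2 : R) ^+ 2.
  by rewrite exprn_even_gt0//= lt_eqF// -(ln1 R) ltr_ln ?posrE.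
have b0 : 0 < ln (ln 3 : R) by rewrite ln_gt0.
exists (Order.min (ln (ln 2) ^+ 2) (ln (ln 3) ^+ 2)).
  by rewrite lt_min a0 exprn_gt0.
move=> n; rewrite leq_eqVlt => /orP[/eqP<-|n3]; first by rewrite ge_min lexx.
rewrite ge_min; apply/orP; right.
have h3 : ln 3 <= ln n%:R :> R by rewrite ler_ln ?posrE ?ltr0n ?ler_nat//; lia.
have h : ln (ln 3) <= ln (ln n%:R) :> R by rewrite ler_ln ?posrE//; lra.
by rewrite lerXn2r// nnegrE; lra.
Qed.

Lemma exists_variance_bound d : (5 <= d)%N -> exists2 c : R, 0 < c &
  forall n, (2 <= n)%N -> exists s : R,
    [/\ 0 < s, c * (2 * s ^+ 2) <= variance_scale d n &
        forall M, subgaussian n (@centered_tcap R d M n) s].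
Proof.
move=> d5; have d0 : (0 < d)%N by lia.
have [d5e|d6] := eqVneq d 5.
  have a1 : (5 / 2 : R) <= 5 / 2 by [].
  have a2 : (5 / 2 : R) < 3 by lra.
  have hK n (x : Zlattice d) : heat n x <=
      Num.sqrt ((2 * d)%:R ^+ d) * npow n (- (5 / 2)) :> R.
    by apply: heat_npow_le => //; rewrite d5e.
  have mc0 := moment_cst_gt0 a1 a2 hK; set mc := moment_cst _ _ in mc0.
  have mc4 : 0 < 4 * mc by rewrite mulr_gt0.
  have [C C0 [f0 fS]] := log_growth mc4.
  pose f (n : nat) : R := C * (1 + ln n.+1%:R).
  have /andP[l2 _] := ln2_bounds; set l := ln 2 in l2.
  (* With [L = ln n >= l], this combines [1 <= L / l] and [ln (n + 1) <= 2 L]. *)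
  have [B BE] : exists B, B = C * (l^-1 + 2) by eexists.
  have B0 : 0 < B by rewrite BE mulr_gt0// addr_gt0 ?invr_gt0.
  (* The 4 pays for [n + 1 <= 2 n] and the 2 in the claim; the factor [l <= L] is exchanged for the
     third logarithm of the scale. *)
  exists (l / (4 * B ^+ 2)); first by rewrite divr_gt0// mulr_gt0// exprn_gt0.
  move=> n n2; exists (Num.sqrt n.+1%:R * f n); split.
  - by rewrite mulr_gt0 ?sqrtr_gt0 ?ltr0n//; exact: f0.
  - rewrite exprMn sqr_sqrtr// /variance_scale d5e/=.
    have n0 : 0 < n%:R :> R by rewrite ltr0n; lia.
    set L := ln n%:R.
    have lL : l <= L by rewrite ler_ln ?posrE// ler_nat.
    have fB : f n <= B * L.
      rewrite BE -mulrA ler_pM2l// mulrDl lerD//.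
        by rewrite ler_pdivlMl// mulr1.
      have -> : 2 * L = ln (n%:R * n%:R) by rewrite lnM ?posrE// -/L; lra.
      by rewrite ler_ln ?posrE ?ltr0n ?mulr_gt0// -natrM ler_nat; nia.
    have fB2 : f n ^+ 2 <= B ^+ 2 * L ^+ 2.
      by rewrite -exprMn lerXn2r ?nnegrE ?(ltW (f0 n))// (le_trans (ltW (f0 n))).
    have nf : n.+1%:R * f n ^+ 2 <= 2 * n%:R * (B ^+ 2 * L ^+ 2).
      by apply: ler_pM; rewrite ?sqr_ge0// -natrM ler_nat; lia.
    rewrite mulrAC ler_pdivrMr ?mulr_gt0 ?exprn_gt0//.
    apply: (@le_trans _ _ (l * (4 * n%:R * B ^+ 2 * L ^+ 2))).
      by rewrite ler_pM2l//; move: nf; set F := f n ^+ 2; lra.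
    rewrite [leRHS](_ : _ = L * (4 * n%:R * B ^+ 2 * L ^+ 2)); last by ring.
    rewrite ler_wpM2r//.
    by have hL := sqr_ge0 L; have hB := sqr_ge0 B; rewrite mulr_ge0// mulr_ge0.
  - move=> M; apply: (centered_tcap_subgaussian d0 a1 a2 hK (f := f)) =>
      [|k m k0 mk]; first exact: f0.
    by rewrite subrr /npow powRr0 mulr1; exact: fS.
have a1 : (5 / 2 : R) <= 11 / 4 by lra.
have a2 : (11 / 4 : R) < 3 by lra.
have hK n (x : Zlattice d) : heat n x <=
    Num.sqrt ((2 * d)%:R ^+ d) * npow n (- (11 / 4)) :> R.
  apply: heat_npow_le => //.
  have : (6 : R) <= d%:R by rewrite ler_nat; lia.
  lra.
have mc0 := moment_cst_gt0 a1 a2 hK; set mc := moment_cst _ _ in mc0.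
have mc4 : 0 < 4 * mc by rewrite mulr_gt0.
have [C C0 [f0 fS]] := bounded_growth mc4.
pose f (n : nat) : R := C * (2 - npow n (- 4^-1)).
have [e e0 lnln] := lnln_sqr_ge.
have e1 : 0 < Order.min e 1 by rewrite lt_min e0 ltr01.
(* The 16 comes from [f n <= 2 C], [n + 1 <= 2 n] and the 2 in the claim; the minimum covers both
   [d = 6], through [e], and [d >= 7]. *)
exists (Order.min e 1 / (16 * C ^+ 2)).
  by rewrite divr_gt0// mulr_gt0// exprn_gt0.
move=> n n2; exists (Num.sqrt n.+1%:R * f n); split.
- by rewrite mulr_gt0 ?sqrtr_gt0 ?ltr0n//; exact: f0.
- rewrite exprMn sqr_sqrtr//.
  have n0 : 0 < n%:R :> R by rewrite ltr0n; lia.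
  have s2 : n.+1%:R * f n ^+ 2 <= 2 * n%:R * (4 * C ^+ 2).
    apply: ler_pM; rewrite ?sqr_ge0//.
      by rewrite -natrM ler_nat; lia.
    rewrite (_ : 4 = 2 ^+ 2 :> R); last by ring.
    rewrite -exprMn lerXn2r ?nnegrE ?(ltW (f0 n)) ?mulr_ge0 ?(ltW C0)//.
    rewrite /f mulrC ler_pM2r// gerBl npow_ge0//.
  apply: (@le_trans _ _ (Order.min e 1 * n%:R)).
    rewrite mulrAC ler_pdivrMr ?mulr_gt0 ?exprn_gt0// -[leRHS]mulrA ler_pM2l//.
    by move: s2; set F := f n ^+ 2; lra.
  rewrite /variance_scale (negbTE d6); case: ifP => _.
    rewrite mulrC ler_pM2l// (le_trans _ (lnln n n2))// ge_min lexx//.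
  by rewrite ler_piMl ?ler0n// ge_min lexx orbT.
- move=> M; apply: (centered_tcap_subgaussian d0 a1 a2 hK (f := f)) =>
    [|k m k0 mk]; first exact: f0.
  rewrite (_ : 5 / 2 - 11 / 4 = - 4^-1); last by lra.
  exact: fS.
Qed.

End scales.

Theorem proposition2p4 (R : realType) :
  exists c : nat -> R,
    (forall d : nat, (5 <= d)%N -> 0 < c d) /\
    forall (d : nat) (hd : (5 <= d)%N)
      (disp : measure_display) (T : measurableType disp)
      (P : Zlattice d -> probability T R) (S : nat -> T -> Zlattice d)
      (hS : forall x, simple_random_walk (P x) S x)
      (n : nat) (hn : (2 <= n)%N) (zeta : R) (hzeta : 0 < zeta),
    let Cap_n := fun w => capacity P S (walk_range S n w) in
    (P 0%R [set w | zeta%:E <= (Cap_n w)%:E - 'E_(P 0%R)[Cap_n]] <=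
      (if d == 5%N then
         expR (- (c 5%N * (zeta ^+ 2 / (n%:R * ln n%:R ^+ 3))))
       else if d == 6%N then
         expR (- (c 6%N * (zeta ^+ 2 / (n%:R * ln (ln n%:R) ^+ 2))))
       else
         expR (- (c d * (zeta ^+ 2 / n%:R))))%:E)%E.
Proof.
(* The constants are fixed before the probability space, the walk, [n] and [zeta], and depend on [d]
   alone. *)
have /choice[c hc] : forall d, exists c : R, (5 <= d)%N -> 0 < c /\
    forall n, (2 <= n)%N -> exists s : R,
      [/\ 0 < s, c * (2 * s ^+ 2) <= variance_scale d n &
          forall M, subgaussian n (@centered_tcap R d M n) s].
  move=> d; have [d5|d5] := boolP (5 <= d)%N; last by exists 0.
  by have [c c0 cn] := @exists_variance_bound R d d5; exists c.
exists c; split=> [d d5|]; first by case: (hc d d5).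
move=> d hd disp T P S hS n hn zeta hzeta.
have [c0 /(_ n hn)[s [s0 cs Xs]]] := hc d hd.
have d0 : (0 < d)%N by lia.
apply: (@le_trans _ _ (expR (- (c d * (zeta ^+ 2 / variance_scale d n))))%:E).
  apply: le_trans (capacity_deviation d0 hS s0 hzeta Xs (fun=> erefl)) _.
  have v0 : 0 < 2 * s ^+ 2 by rewrite mulr_gt0// exprn_gt0.
  rewrite lee_fin ler_expR lerN2 mulrCA ler_pM2l ?exprn_gt0//.
  rewrite ler_pdivrMr ?(lt_le_trans _ cs) ?mulr_gt0//.
  by rewrite mulrC ler_pdivlMr// mulrC.
rewrite /variance_scale lee_fin.
have [->//|_] := eqVneq d 5%N; by have [->//|_] := eqVneq d 6%N.
Qed.
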